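(* Let $(X_1,\dots,X_n)$ and $(Y_1,\dots,Y_n)$ be two $n$-tuples of commuting self-adjoint variables in tracial $C^*$-probability spaces (the $X_j$ commute with each other, and the $Y_j$ commute with each other). Then the free and classical Wasserstein distances are equal: $$W((X_1,\dots,X_n),(Y_1,\dots,Y_n))=W(\mu_{X_1,\dots,X_n},\mu_{Y_1,\dots,Y_n}).$$
   Context: A tracial $C^*$-probability space $(M,\tau)$ is a unital $C^*$-algebra $M$ with a trace state $\tau$. A noncommutative random variable in $(M,\tau)$ is an element of $M$. The $*$-distribution of an $n$-tuple in $(M,\tau)$ is the collection of values of $\tau$ on all noncommutative polynomials in the elements of the tuple and their adjoints. For $T\in M$, $|T|_2=\tau(T^*T)^{1/2}$. Free Wasserstein distance: for $n$-tuples $(X_1,\dots,X_n)$ in $(M_1,\tau_1)$ and $(Y_1,\dots,Y_n)$ in $(M_2,\tau_2)$, $W((X_1,\dots,X_n),(Y_1,\dots,Y_n))$ is the infimum of $\left(\sum_{j=1}^n|X'_j-Y'_j|_2^2\right)^{1/2}$ over all $2n$-tuples $(X'_1,\dots,X'_n,Y'_1,\dots,Y'_n)$ of noncommutative random variables in some tracial $C^*$-probability space $(M_3,\tau_3)$ such that $(X'_1,\dots,X'_n)$ has the same $*$-distribution as $(X_1,\dots,X_n)$ and $(Y'_1,\dots,Y'_n)$ has the same $*$-distribution as $(Y_1,\dots,Y_n)$. If $(X_1,\dots,X_n)$ are commuting self-adjoint variables in $(M,\tau)$, their distribution $\mu_{X_1,\dots,X_n}$ is the compactly supported probability measure on $\mathbb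 R^n$ with $\tau(f(X_1,\dots,X_n))=\int f\,d\mu_{X_1,\dots,X_n}$ for all polynomials $f$. Classical Wasserstein distance: for probability measures $\mu,\nu$ on $\mathbb R^n$, $W(\mu,\nu)=\inf_{\pi\in\Pi(\mu,\nu)}\left(\int|x-y|^2\,d\pi(x,y)\right)^{1/2}$, where $\Pi(\mu,\nu)$ is the set of probability measures on $\mathbb R^n\times\mathbb R^n$ with marginals $\mu$ and $\nu$. *)

(* Defs.v *)
From HB Require Import structures.
From mathcomp Require Import all_boot all_order all_algebra.
From mathcomp Require Import all_classical all_reals all_analysis.
From mathcomp Require Import complex.
(* The notations of mpoly and monalg clash with those of mathcomp-analysis. *)
From mathcomp Require mpoly monalg.
Import (canonicals, coercions) mpoly monalg finmap.

Set Implicit Arguments.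
Unset Strict Implicit.
Unset Printing Implicit Defensive.

Import Order.TTheory GRing.Theory Num.Theory numFieldNormedType.Exports.

Local Open Scope classical_set_scope.
Local Open Scope complex_scope.
Local Open Scope ring_scope.

(* Unital C*-algebras.  The norm is a real-valued operation of the mixin and
   not the one of completeNormedModType R[i]: that structure has no join with
   GRing.Algebra in the hierarchy (only numDomainType lies above a normed
   module and a ring), and its norm would take values in R[i].  The axiom
   1 != 0 of GRing.Algebra is no restriction here, a state having value 1
   at 1. *)
HB.mixin Record isCstarAlgebra (R : realType) M & GRing.Algebra R[i] M := {
  adj : M -> M;
  adjK : involutive adj;
  adjD : {morph adj : x y / x + y};
  adjZ : forall (a : R[i]) (x : M), adj (a *: x) = a^* *: adj x;
  adjM : forall x y : M, adj (x * y) = adj y * adj x;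
  cstar_norm : M -> R;
  cstar_norm0_eq0 : forall x : M, cstar_norm x = 0 -> x = 0;
  cstar_normD : forall x y : M,
    cstar_norm (x + y) <= cstar_norm x + cstar_norm y;
  cstar_normZ : forall (a : R[i]) (x : M),
    cstar_norm (a *: x) = complex.Re `|a| * cstar_norm x;
  cstar_normM : forall x y : M,
    cstar_norm (x * y) <= cstar_norm x * cstar_norm y;
  cstar_identity : forall x : M, cstar_norm (adj x * x) = cstar_norm x ^+ 2;
  cstar_complete : forall u : nat -> M,
    (forall e : R, 0 < e -> exists N, forall m k : nat,
       (N <= m)%N -> (N <= k)%N -> cstar_norm (u m - u k) < e) ->
    exists l : M, forall e : R, 0 < e -> exists N, forall m : nat,
      (N <= m)%N -> cstar_norm (u m - l) < e
}.

#[short(type="cstarAlgType")]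
HB.structure Definition CstarAlgebra (R : realType) :=
  { M of GRing.Algebra R[i] M & isCstarAlgebra R M }.

(* In tau_ge0 the order is that of R[i]: 0 <= z means that z is real and
   nonnegative. *)
Record tracialSpace (R : realType) := TracialSpace {
  tracial_alg :> cstarAlgType R;
  tau : {scalar tracial_alg};
  tau1 : tau 1 = 1;
  tau_ge0 : forall x : tracial_alg, 0 <= tau (adj x * x);
  tau_trace : forall x y : tracial_alg, tau (x * y) = tau (y * x)
}.

Definition norm2 (R : realType) (M : tracialSpace R) (T : M) : R :=
  Num.sqrt (complex.Re (tau M (adj T * T))).

(* Noncommutative polynomials in n indeterminates and their adjoints: finite
   combinations of words, the letter (j, false) being the j-th indeterminate
   and (j, true) its adjoint. *)
Definition starPoly (R : realType) (n : nat) :=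
  monalg.malg (monalg.fmonom ('I_n * bool)%type) R[i].

Definition star_eval (R : realType) (n : nat) (M : cstarAlgType R)
    (X : 'I_n -> M) (P : starPoly R n) : M :=
  \sum_(w <- finmap.enum_fset (monalg.msupp P)) monalg.mcoeff w P *:
    \prod_(l <- monalg.fmonom_val w) (if l.2 then adj (X l.1) else X l.1).

Definition same_star_distribution (R : realType) (n : nat)
    (M1 M2 : tracialSpace R) (X : 'I_n -> M1) (Y : 'I_n -> M2) : Prop :=
  forall P : starPoly R n, tau M1 (star_eval X P) = tau M2 (star_eval Y P).

Definition free_wasserstein (R : realType) (n : nat)
    (M1 M2 : tracialSpace R) (X : 'I_n -> M1) (Y : 'I_n -> M2) : \bar R :=
  ereal_inf [set d : \bar R |
    exists (M3 : tracialSpace R) (X' Y' : 'I_n -> M3),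
      [/\ same_star_distribution X' X,
          same_star_distribution Y' Y &
          d = (Num.sqrt (\sum_(j < n) norm2 (X' j - Y' j) ^+ 2))%:E]].

Definition commuting_selfadjoint (R : realType) (n : nat) (M : cstarAlgType R)
    (X : 'I_n -> M) : Prop :=
  (forall j, adj (X j) = X j) /\ (forall j k, X j * X k = X k * X j).

(* R^n is n.-tuple R, whose sigma-algebra is the product of the Borel ones,
   i.e. the Borel sigma-algebra of R^n; compactness is that of 'rV[R]_n. *)
Definition compactly_supported (R : realType) (n : nat)
    (mu : probability (n.-tuple R) R) : Prop :=
  exists K : set 'rV[R]_n, compact K /\
    mu.-negligible [set x : n.-tuple R | ~ K (\row_j tnth x j)].

Definition is_distribution (R : realType) (n : nat) (M : tracialSpace R)
    (X : 'I_n -> M) (mu : probability (n.-tuple R) R) : Prop :=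
  compactly_supported mu /\
  forall f : mpoly.mpoly n R,
    tau M (mpoly.mmap (fun c : R => c%:C%:A) X f) =
    (\int[mu]_x mpoly.meval (tnth x) f)%:C.

Definition coupling (R : realType) (n : nat)
    (mu nu : probability (n.-tuple R) R)
    (pi : probability (n.-tuple R * n.-tuple R)%type R) : Prop :=
  forall A : set (n.-tuple R), measurable A ->
    pi (A `*` setT) = mu A /\ pi (setT `*` A) = nu A.

Definition wasserstein (R : realType) (n : nat)
    (mu nu : probability (n.-tuple R) R) : \bar R :=
  ereal_inf [set d : \bar R |
    exists2 pi : probability (n.-tuple R * n.-tuple R)%type R,
      coupling mu nu pi &
      d = sqrte (\int[pi]_z
            (\sum_(j < n) (tnth z.1 j - tnth z.2 j) ^+ 2)%:E)].

(* Main.v *)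
From HB Require Import structures.
From mathcomp Require Import all_boot all_order all_algebra.
From mathcomp Require Import all_classical all_reals all_analysis.
From mathcomp Require Import measurable_realfun.
From mathcomp Require Import complex ring lra.
From mathcomp Require mpoly monalg.
Require Import Defs.
Import (canonicals, coercions) mpoly monalg.

(** The free distance compares couplings of the two tuples inside arbitrary
    tracial algebras, the classical one compares couplings of their laws; the
    point is that each kind of coupling yields one of the other kind at no
    greater cost, up to an arbitrarily small error.

    From classical to free ([free_le_coupling_cost]): given a coupling [pi],
    the bounded measurable functions on the product space form a C*-algebra
    with the integral against [pi] as trace, and the two families of
    coordinates, cut off to a box that carries the laws, are the required
    tuples.  Their squared distance is the cost of [pi].

    From free to classical ([wasserstein_le_free_pair]): let [X'] and [Y'] live
    in one tracial algebra.  They do not commute with each other, so they have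
    no joint law, but the bilinear form [B(p, q) = Re tau (p(X') q(Y'))] on
    polynomials ([correlation]) behaves like integration of [p x * q y]:
    its marginals [B(p, 1)] and [B(1, q)] are the integrals against [mu] and
    [nu], it satisfies a Cauchy-Schwarz inequality with the second moments of
    [p] under [mu] and of [q] under [nu], and it is nonnegative when [p] and
    [q] take values between 0 and 1 on the box, since such polynomials are
    limits of squares and [tau (a^2 c^2) = tau ((a c)^* (a c))] for
    self-adjoint [a] and [c].  The squared distance of the tuples is
    [sum_j (E_mu x_j^2 + E_nu y_j^2 - 2 B(x_j, y_j))].

    This form is turned into a true coupling by discretization.  Take a
    polynomial partition of unity [b_i] on the box, each [b_i] concentrated
    near a point ([partition_of_unity]).  The matrix [B(b_i, b_k)] is
    nonnegative with the cell masses of [mu] and [nu] as row and column sums,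
    so it mixes products of conditioned laws into a coupling of [mu] and [nu]
    ([coupling_from_weights]).  Its mixed moments are [B(T x_j, S y_j)], where
    [T] and [S] average over the cells; the averages are close to the
    coordinates in quadratic mean ([cell_average_close]), so Cauchy-Schwarz
    bounds the change of cost ([coupling_near_correlation]).

    Two devices keep this elementary.  [X'] has the star-distribution of a
    commuting self-adjoint tuple without being one, so relations are used only
    modulo the radical of the trace ([negligible_elt]).  And partitions are
    polynomial, so that [B] never has to be extended beyond polynomials. *)

Set Implicit Arguments.
Unset Strict Implicit.
Unset Printing Implicit Defensive.

Import Order.TTheory GRing.Theory Num.Theory numFieldNormedType.Exports.

Local Open Scope classical_set_scope.
Local Open Scope complex_scope.
Local Open Scope ring_scope.

(** * Complex scalars *)

Section ComplexScalars.
Variable R : realType.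
Implicit Types a b : R[i].

Lemma Re_add a b : complex.Re (a + b) = complex.Re a + complex.Re b.
Proof. by case: a; case: b. Qed.

Lemma Re_opp a : complex.Re (- a) = - complex.Re a.
Proof. by case: a. Qed.

Lemma Re_realM (c : R) a : complex.Re (c%:C * a) = c * complex.Re a.
Proof. by case: a => a b /=; rewrite mul0r subr0. Qed.

(** Bridges the two conjugations on [R[i]]: that of numerically closed fields,
    which is the one in [adjZ], and the explicit one. *)
Lemma conj_complexE a : a^* = conjc a.
Proof. by []. Qed.

Definition modulus a : R := complex.Re `|a|.

Lemma modulusE a : `|a| = (modulus a)%:C.
Proof. by case: a. Qed.

Lemma modulus_sqr a : modulus a ^+ 2 = complex.Re a ^+ 2 + complex.Im a ^+ 2.
Proof.
by case: a => x y; rewrite /modulus /= sqr_sqrtr// addr_ge0 ?sqr_ge0.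
Qed.

Lemma modulus_ge0 a : 0 <= modulus a.
Proof. by case: a => x y; rewrite /modulus /= sqrtr_ge0. Qed.

Lemma modulusM a b : modulus (a * b) = modulus a * modulus b.
Proof.
have : (modulus (a * b))%:C = (modulus a)%:C * (modulus b)%:C.
  by rewrite -!modulusE normrM.
by rewrite -rmorphM => -[].
Qed.

Lemma modulusD a b : modulus (a + b) <= modulus a + modulus b.
Proof. by have := ler_normD a b; rewrite !modulusE -rmorphD lecR. Qed.

Lemma modulus_conj a : modulus (conjc a) = modulus a.
Proof. by case: a => x y; rewrite /modulus /= sqrrN. Qed.

Lemma modulus_eq0 a : modulus a = 0 -> a = 0.
Proof. by move=> a0; apply/eqP; rewrite -normr_eq0 modulusE a0. Qed.

Lemma Re_le_modulus a : `|complex.Re a| <= modulus a.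
Proof.
rewrite -(@ler_pXn2r _ 2)// ?nnegrE ?modulus_ge0// modulus_sqr.
by rewrite (real_normK (num_real _)) lerDl sqr_ge0.
Qed.

Lemma Im_le_modulus a : `|complex.Im a| <= modulus a.
Proof.
rewrite -(@ler_pXn2r _ 2)// ?nnegrE ?modulus_ge0// modulus_sqr.
by rewrite (real_normK (num_real _)) lerDr sqr_ge0.
Qed.

Lemma modulus_le_ReIm a : modulus a <= `|complex.Re a| + `|complex.Im a|.
Proof.
rewrite -(@ler_pXn2r _ 2)// ?nnegrE ?modulus_ge0 ?addr_ge0// modulus_sqr.
rewrite sqrrD !(real_normK (num_real _)) -addrA lerD2l lerDr.
by rewrite mulrn_wge0// mulr_ge0.
Qed.

End ComplexScalars.

(** * The semi-inner product of a trace *)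

Section StarAlgebra.
Variables (R : realType) (M : cstarAlgType R).
Implicit Types x y : M.

Lemma adj0 : adj (0 : M) = 0.
Proof. by apply: (addrI (adj 0)); rewrite -adjD !addr0. Qed.

Lemma adj1 : adj (1 : M) = 1.
Proof. by have := adjM (adj (1 : M)) 1; rewrite mulr1 !adjK mulr1 => /esym. Qed.

End StarAlgebra.

Section TraceState.
Variables (R : realType) (M : tracialSpace R).
Implicit Types x y z : M.
Local Notation tr := (tau M).

Definition trace_inner x y : R := complex.Re (tr (adj x * y)).

Lemma trace_inner_ge0 x : 0 <= trace_inner x x.
Proof. by have := tau_ge0 x; rewrite lecE => /andP[]. Qed.

Lemma trace_innerDl x y z :
  trace_inner (x + y) z = trace_inner x z + trace_inner y z.
Proof. by rewrite /trace_inner adjD mulrDl linearD Re_add. Qed.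

Lemma trace_innerDr x y z :
  trace_inner z (x + y) = trace_inner z x + trace_inner z y.
Proof. by rewrite /trace_inner mulrDr linearD Re_add. Qed.

Lemma trace_innerZr (c : R) x y :
  trace_inner x (c%:C *: y) = c * trace_inner x y.
Proof. by rewrite /trace_inner -scalerAr linearZ Re_realM. Qed.

Lemma trace_innerZl (c : R) x y :
  trace_inner (c%:C *: x) y = c * trace_inner x y.
Proof.
rewrite /trace_inner adjZ -scalerAl linearZ conj_complexE.
by rewrite conjc_real Re_realM.
Qed.

(** Positivity on [x + i y] makes the sum of the two cross terms real; this
    is the symmetry of the real part. *)
Lemma trace_innerC x y : trace_inner x y = trace_inner y x.
Proof.
have Im0 u : complex.Im (tr (adj u * u)) = 0.
  by have := tau_ge0 u; rewrite lecE => /andP[/eqP].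
have := Im0 (x + (0 +i* 1) *: y).
rewrite adjD adjZ !mulrDr !mulrDl !linearD /= -!scalerAr -!scalerAl.
rewrite !linearZ /= /trace_inner conj_complexE.
move: (Im0 x) (Im0 y).
case: (tr (adj x * x)) => a b; case: (tr (adj y * y)) => c d.
case: (tr (adj x * y)) => e f; case: (tr (adj y * x)) => g h /=.
lra.
Qed.

Lemma trace_inner_CS x y :
  trace_inner x y ^+ 2 <= trace_inner x x * trace_inner y y.
Proof.
have Q t : 0 <= trace_inner x x + t * trace_inner x y *+ 2
             + t ^+ 2 * trace_inner y y.
  have := trace_inner_ge0 (x + t%:C *: y).
  rewrite !trace_innerDl !trace_innerDr !trace_innerZl !trace_innerZr.
  rewrite (trace_innerC y x) => /le_trans; apply; rewrite le_eqVlt.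
  by apply/orP; left; apply/eqP; ring.
have := trace_inner_ge0 y; rewrite le_eqVlt => /predU1P[y0|y0].
  rewrite -y0 mulr0; have [xy0|xy0] := eqVneq (trace_inner x y) 0.
    by rewrite xy0 expr0n.
  (* The quadratic [Q] is affine in [t] here and would take the value -1. *)
  have := Q (- (trace_inner x x + 1) / (trace_inner x y *+ 2)).
  rewrite -y0 mulr0 addr0 -mulrnAr divfK ?mulrn_eq0//.
  by rewrite opprD addrA subrr add0r oppr_ge0 ler10.
have := Q (- (trace_inner x y / trace_inner y y)).
set a := trace_inner x x; set b := trace_inner x y; set c := trace_inner y y.
have -> : a + - (b / c) * b *+ 2 + (- (b / c)) ^+ 2 * c = a - b ^+ 2 / c.
  by field; rewrite gt_eqF.
by rewrite subr_ge0 ler_pdivrMr.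
Qed.

(** The radical of the trace.  Working modulo it replaces the passage to the
    GNS quotient, in which it becomes zero; by traciality it is a two-sided
    ideal. *)
Definition negligible_elt x := forall z, tr (z * x) = 0.

(** Cauchy-Schwarz, applied to [x] against [adj z] for the real part and
    against [adj (i z)] for the imaginary part. *)
Lemma square_null_negligible x : tr (adj x * x) = 0 -> negligible_elt x.
Proof.
move=> x0.
have N z : trace_inner z x = 0.
  apply/eqP; rewrite -sqrf_eq0; apply/eqP/le_anti; rewrite sqr_ge0 andbT.
  by apply: le_trans (trace_inner_CS z x) _; rewrite {2}/trace_inner x0 mulr0.
move=> z; have := N (adj z); have := N (adj ((0 +i* 1) *: z)).
rewrite /trace_inner !adjK -scalerAl linearZ /=.
by case: (tr (z * x)) => a b /= h1 h2; apply/eqP; rewrite eq_complex/= h2 eqxx;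
   apply/eqP; lra.
Qed.

Lemma tau_eq_mod a b : negligible_elt (a - b) ->
  forall y z, tr (y * a * z) = tr (y * b * z).
Proof.
move=> ab y z; apply/eqP; rewrite -subr_eq0 -linearB /= -mulrBl -mulrBr.
by rewrite tau_trace mulrA ab.
Qed.

End TraceState.

(** * Transfer along equal star-distributions *)

Section StarEval.
Variables (R : realType) (n : nat) (M : cstarAlgType R) (X : 'I_n -> M).

Definition word_eval (w : monalg.fmonom ('I_n * bool)%type) : M :=
  \prod_(l <- monalg.fmonom_val w) (if l.2 then adj (X l.1) else X l.1).

Lemma word_eval_morphism : monalg.mmorphism word_eval.
Proof.
split; last by rewrite /word_eval monalg.fm1 big_nil.
by move=> w1 w2; rewrite /word_eval monalg.fmM big_cat.
Qed.

Canonical word_eval_mmorphism := monalg.MMorphism.Pack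
  (monalg.MMorphism.Class
    (monalg.isMultiplicative.phant_Build word_eval_morphism)).

Lemma star_evalE P : star_eval X P = monalg.mmap (GRing.in_alg M) word_eval P.
Proof. by apply: eq_bigr => w _; rewrite /= mulr_algl. Qed.

Lemma star_evalD P Q : star_eval X (P + Q) = star_eval X P + star_eval X Q.
Proof. by rewrite !star_evalE monalg.mmapD. Qed.

Lemma star_evalM (P Q : starPoly R n) :
  star_eval X (P * Q) = star_eval X P * star_eval X Q.
Proof.
rewrite !star_evalE.
suff [H _] : GRing.multiplicative (monalg.mmap (GRing.in_alg M) word_eval)
  by exact: H.
apply: (@monalg.commr_mmap_is_multiplicative _ _ _ (GRing.in_alg M)
  word_eval_mmorphism) => g w w'.
by rewrite /GRing.comm /= mulr_algl mulr_algr.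
Qed.

Lemma star_evalU (c : R[i]) w :
  star_eval X (monalg.mkmalgU w c) = c *: word_eval w.
Proof. by rewrite star_evalE monalg.mmapU /= mulr_algl. Qed.

End StarEval.

Section StarRelated.
Variables (R : realType) (n : nat) (M M' : cstarAlgType R).
Variables (X : 'I_n -> M) (X' : 'I_n -> M').

(** [a] and [a'] are values of one and the same star-polynomial.  The closure
    properties of this relation are all that is used of star-polynomials:
    an identity that holds for [X] passes to [X'] up to a negligible element. *)
Definition star_related (a : M) (a' : M') :=
  exists P : starPoly R n, a = star_eval X P /\ a' = star_eval X' P.

Lemma star_relatedD a a' b b' : star_related a a' -> star_related b b' ->
  star_related (a + b) (a' + b').
Proof.
by case=> P [-> ->] [Q [-> ->]]; exists (P + Q); rewrite !star_evalD.
Qed.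

Lemma star_relatedM a a' b b' : star_related a a' -> star_related b b' ->
  star_related (a * b) (a' * b').
Proof.
by case=> P [-> ->] [Q [-> ->]]; exists (P * Q); rewrite !star_evalM.
Qed.

Lemma star_related_cst (c : R[i]) : star_related c%:A c%:A.
Proof.
exists (monalg.mkmalgU monalg.one c).
by rewrite !star_evalU /word_eval !monalg.fm1 !big_nil.
Qed.

Lemma star_relatedZ (c : R[i]) a a' : star_related a a' ->
  star_related (c *: a) (c *: a').
Proof.
by move=> aa'; rewrite -[c *: a]mulr_algl -[c *: a']mulr_algl;
   apply: star_relatedM => //; exact: star_related_cst.
Qed.

Lemma star_relatedB a a' b b' : star_related a a' -> star_related b b' ->
  star_related (a - b) (a' - b').
Proof.
move=> aa' bb'; rewrite -(scaleN1r b) -(scaleN1r b').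
by apply: star_relatedD => //; exact: star_relatedZ.
Qed.

Lemma star_related1 : star_related 1 1.
Proof. by have := star_related_cst 1; rewrite !scale1r. Qed.

Lemma star_related0 : star_related 0 0.
Proof. by have := star_related_cst 0; rewrite !scale0r. Qed.

Lemma star_related_sum (I : Type) (r : seq I) (F : I -> M) (F' : I -> M') :
  (forall i, star_related (F i) (F' i)) ->
  star_related (\sum_(i <- r) F i) (\sum_(i <- r) F' i).
Proof.
by move=> FF'; elim/big_ind2: _ => [|a a' b b'|i _];
  [exact: star_related0|exact: star_relatedD|exact: FF'].
Qed.

Lemma star_related_prod (I : Type) (r : seq I) (F : I -> M) (F' : I -> M') :
  (forall i, star_related (F i) (F' i)) ->
  star_related (\prod_(i <- r) F i) (\prod_(i <- r) F' i).
Proof.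
by move=> FF'; elim/big_ind2: _ => [|a a' b b'|i _];
  [exact: star_related1|exact: star_relatedM|exact: FF'].
Qed.

Lemma star_relatedX a a' k : star_related a a' ->
  star_related (a ^+ k) (a' ^+ k).
Proof.
move=> aa'; elim: k => [|k ih]; first exact: star_related1.
by rewrite !exprS; exact: star_relatedM.
Qed.

Lemma star_related_letter j (b : bool) :
  star_related (if b then adj (X j) else X j) (if b then adj (X' j) else X' j).
Proof.
exists (monalg.mkmalgU (monalg.fmu (j, b)) 1).
by rewrite !star_evalU /word_eval !monalg.fmU !big_seq1 !scale1r.
Qed.

Lemma star_related_var j : star_related (X j) (X' j).
Proof. exact: (star_related_letter j false). Qed.

Lemma star_related_adj a a' : star_related a a' ->
  star_related (adj a) (adj a').
Proof.
case=> P [-> ->]; rewrite /star_eval.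
elim/big_ind2: _ => [|x x' y y' xx' yy'|w _].
- by rewrite !adj0; exact: star_related0.
- by rewrite !adjD; exact: star_relatedD.
- rewrite !adjZ; apply: star_relatedZ.
  elim/big_ind2: _ => [|x x' y y' xx' yy'|l _].
  + by rewrite !adj1; exact: star_related1.
  + by rewrite !adjM; exact: star_relatedM.
  + have := star_related_letter l.1 (~~ l.2).
    by case: l => l [] /=; rewrite ?adjK.
Qed.

End StarRelated.

(** * Real polynomials of commuting self-adjoint elements *)

Section RealPolynomialCalculus.
Variables (R : realType) (n : nat) (M : cstarAlgType R) (X : 'I_n -> M).
Implicit Types p q : mpoly.mpoly n R.

(** The monomials are evaluated in increasing order of the variables; this is
    a ring morphism as soon as the [X j] commute. *)
Definition poly_calc p : M := mpoly.mmap (fun c : R => c%:C%:A) X p.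

Lemma poly_calcE : poly_calc = mpoly.mmap (GRing.in_alg M \o real_complex R) X.
Proof. by []. Qed.

Lemma poly_calcD p q : poly_calc (p + q) = poly_calc p + poly_calc q.
Proof. by rewrite poly_calcE mpoly.mmapD. Qed.

Lemma poly_calcZ (c : R) p : poly_calc (c *: p) = c%:C *: poly_calc p.
Proof. by rewrite poly_calcE mpoly.mmapZ /= mulr_algl. Qed.

Lemma poly_calc1 : poly_calc 1 = 1.
Proof. by rewrite poly_calcE -mpoly.mpolyC1 mpoly.mmapC /= scale1r. Qed.

Lemma poly_calcX j : poly_calc (mpoly.mpolyX R (mpoly.mnm1 j)) = X j.
Proof. by rewrite poly_calcE mpoly.mmapX mpoly.mmap1U. Qed.

End RealPolynomialCalculus.

Section CommutingCalculus.
Variables (R : realType) (n : nat) (M : cstarAlgType R) (X : 'I_n -> M).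
Hypothesis X_comm : commuting_selfadjoint X.
Implicit Types p q : mpoly.mpoly n R.

Lemma monomial_calcM m1 m2 :
  mpoly.mmap1 X (mpoly.mnm_add m1 m2) = mpoly.mmap1 X m1 * mpoly.mmap1 X m2.
Proof.
rewrite /mpoly.mmap1 -prodrM_comm => [|i j _ _]; last first.
  by apply: commrX; apply: commr_sym; apply: commrX; exact: X_comm.2.
by apply: eq_bigr => i _; rewrite mpoly.mnmDE exprD.
Qed.

Lemma monomial_calc_adj m : adj (mpoly.mmap1 X m) = mpoly.mmap1 X m.
Proof.
rewrite /mpoly.mmap1.
suff [] : adj (\prod_(i < n) X i ^+ m i) = \prod_(i < n) X i ^+ m i /\
    forall j, GRing.comm (X j) (\prod_(i < n) X i ^+ m i) by [].
elim/big_rec: _ => [|i a _ [aa ca]].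
  by rewrite adj1; split => // j; exact: commr1.
have adjX k : adj (X i ^+ k) = X i ^+ k.
  elim: k => [|k ih]; first exact: adj1.
  by rewrite exprS adjM ih X_comm.1 -exprSr exprS.
split=> [|j].
  by rewrite adjM aa adjX; apply: commrX; apply: commr_sym; exact: ca.
by apply: commrM => //; apply: commrX; exact: X_comm.2.
Qed.

Lemma poly_calc_monomial m :
  poly_calc X (mpoly.mpolyX R m) = mpoly.mmap1 X m.
Proof. by rewrite poly_calcE mpoly.mmapX. Qed.

Lemma poly_calc0 : poly_calc X (0 : mpoly.mpoly n R) = 0.
Proof. by rewrite poly_calcE mpoly.mmap0. Qed.

Lemma poly_calcM p q : poly_calc X (p * q) = poly_calc X p * poly_calc X q.
Proof.
elim/mpoly.mpolyind: p => [|c m p _ _ ih].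
  by rewrite mul0r poly_calc0 mul0r.
rewrite mulrDl !poly_calcD mulrDl ih; congr (_ + _).
rewrite -scalerAl !poly_calcZ -scalerAl; congr (_ *: _).
elim/mpoly.mpolyind: q {ih} => [|d m' q _ _ ih'].
  by rewrite mulr0 poly_calc0 mulr0.
rewrite mulrDr !poly_calcD mulrDr ih'; congr (_ + _).
rewrite -scalerAr !poly_calcZ -scalerAr -mpoly.mpolyXD !poly_calc_monomial.
by rewrite monomial_calcM.
Qed.

Lemma poly_calc_adj p : adj (poly_calc X p) = poly_calc X p.
Proof.
elim/mpoly.mpolyind: p => [|c m p _ _ ih]; first by rewrite poly_calc0 adj0.
rewrite poly_calcD adjD ih poly_calcZ adjZ conj_complexE conjc_real.
by rewrite poly_calc_monomial monomial_calc_adj.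
Qed.

Lemma poly_calc_word (w : seq ('I_n * bool)) :
  \prod_(l <- w) (if l.2 then adj (X l.1) else X l.1) =
  poly_calc X (\prod_(l <- w) mpoly.mpolyX R (mpoly.mnm1 l.1)).
Proof.
elim: w => [|l w ih]; first by rewrite !big_nil poly_calc1.
by rewrite !big_cons ih poly_calcM poly_calcX X_comm.1 if_same.
Qed.

End CommutingCalculus.

Section SameDistribution.
Variables (R : realType) (n : nat) (M M' : tracialSpace R).
Variables (X : 'I_n -> M) (X' : 'I_n -> M').
Hypothesis XX' : same_star_distribution X' X.
Implicit Types p q : mpoly.mpoly n R.

Lemma tau_star_related a a' : star_related X X' a a' -> tau M' a' = tau M a.
Proof. by case=> P [-> ->]; exact: XX'. Qed.

(** If [a'] is a star-polynomial of [X'] whose value on [X] is zero, then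
    [adj a' * a'] has the trace of [adj 0 * 0]. *)
Lemma star_related0_negligible a' : star_related X X' 0 a' -> negligible_elt a'.
Proof.
move=> aa'; apply: square_null_negligible.
have r := star_relatedM (star_related_adj aa') aa'.
by rewrite (tau_star_related r) mulr0 linear0.
Qed.

Lemma poly_calc_related p : star_related X X' (poly_calc X p) (poly_calc X' p).
Proof.
rewrite /poly_calc /mpoly.mmap; apply: star_related_sum => m.
apply: star_relatedM; first exact: star_related_cst.
by apply: star_related_prod => i; apply: star_relatedX; exact: star_related_var.
Qed.

Hypothesis X_comm : commuting_selfadjoint X.

(** The tuple [X'] need not commute, but its polynomial calculus is
    multiplicative up to negligible elements because that of [X] is. *)
Lemma poly_calcM_mod p q :
  negligible_elt (poly_calc X' p * poly_calc X' q - poly_calc X' (p * q)).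
Proof.
apply: star_related0_negligible.
rewrite -[X in star_related _ _ X](subrr (poly_calc X (p * q))).
rewrite {1}(poly_calcM X_comm).
apply: star_relatedB; last exact: poly_calc_related.
by apply: star_relatedM; exact: poly_calc_related.
Qed.

Lemma poly_calc_adj_mod p :
  negligible_elt (adj (poly_calc X' p) - poly_calc X' p).
Proof.
apply: star_related0_negligible.
rewrite -[X in star_related _ _ X](subrr (poly_calc X p)).
rewrite -{1}(poly_calc_adj X_comm).
apply: star_relatedB; last exact: poly_calc_related.
by apply: star_related_adj; exact: poly_calc_related.
Qed.

End SameDistribution.

(** * Polynomials between 0 and 1 as limits of squares *)

Section PolynomialsOnBox.
Variables (R : realType) (n : nat) (C : R).
Implicit Types (p q : mpoly.mpoly n R) (v : 'I_n -> R).

Definition in_box v := forall j, `|v j| <= C.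

Definition between01 p := forall v, in_box v -> 0 <= mpoly.meval v p <= 1.

(** The classical iteration [q + (p - q^2) / 2], which increases to the square
    root of [p] wherever [p] lies between 0 and 1, and stays polynomial. *)
Fixpoint sqrt_iter p (m : nat) : mpoly.mpoly n R :=
  if m is m'.+1 then
    let q := sqrt_iter p m' in q + 2^-1 *: (p - q * q)
  else 0.

(** The error satisfies [s - q_m <= 2 s / (2 + m s)], by the induction step
    [(1 - s / 2) (2 + (m + 1) s) <= 2 + m s]. *)
Lemma sqrt_iter_bounds p m v (s := Num.sqrt (mpoly.meval v p))
    (q := mpoly.meval v (sqrt_iter p m)) :
  0 <= mpoly.meval v p <= 1 ->
  0 <= q <= s /\ (s - q) * (2 + m%:R * s) <= 2 * s.
Proof.
rewrite {}/q => /andP[p0 p1].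
have s2 : mpoly.meval v p = s ^+ 2 by rewrite sqr_sqrtr.
have s0 : 0 <= s by exact: sqrtr_ge0.
have s1 : s <= 1 by rewrite -(@expr_le1 _ 2)// -s2.
elim: m => [|m [/andP[q0 qs] ih]] /=.
  by rewrite mpoly.meval0; split; [rewrite lexx|lra].
rewrite mpoly.mevalD mpoly.mevalZ mpoly.mevalB mpoly.mevalM s2.
set q := mpoly.meval v (sqrt_iter p m) in q0 qs ih *.
have -> : s - (q + 2^-1 * (s ^+ 2 - q * q)) = (s - q) * (1 - (s + q) / 2).
  by field.
have m0 : 0 <= m%:R :> R by [].
rewrite -[m.+1%:R]natr1; move: (m%:R) m0 ih => k k0 ih; split.
  have sq0 : 0 <= (s - q) * (s + q) by rewrite mulr_ge0; lra.
  have sq1 : 0 <= (s - q) * (1 - (s + q) / 2) by rewrite mulr_ge0; lra.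
  apply/andP; split.
    rewrite (_ : _ + _ = q + (s - q) * (s + q) / 2); last by field.
    by rewrite addr_ge0// divr_ge0.
  rewrite -subr_ge0 (_ : _ - _ = (s - q) * (1 - (s + q) / 2))//.
  by field.
have A : (s - q) * (1 - (s + q) / 2) <= (s - q) * (1 - s / 2).
  by rewrite ler_wpM2l//; lra.
have D0 : 0 <= 2 + (k + 1) * s by rewrite addr_ge0// mulr_ge0// addr_ge0.
apply: (le_trans (ler_wpM2r D0 A)).
have E : (1 - s / 2) * (2 + (k + 1) * s) <= 2 + k * s.
  rewrite -subr_ge0 (_ : _ - _ = (k + 1) * s ^+ 2 / 2); last by field.
  by rewrite divr_ge0// mulr_ge0 ?sqr_ge0// addr_ge0.
by rewrite -mulrA; apply: le_trans ih; rewrite ler_wpM2l// subr_ge0.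
Qed.

(** Stands in for the square root in a functional calculus.  For self-adjoint
    [a] and [c] the trace of [a^2 c^2] is nonnegative; the approximation
    carries this over to polynomials that are between 0 and 1 on the box. *)
Lemma between01_square_limit p : between01 p ->
  forall e : R, 0 < e -> exists q, forall v, in_box v ->
    `|mpoly.meval v p - mpoly.meval v q ^+ 2| <= e.
Proof.
move=> p01 e e0.
have [m me] : exists m : nat, 4 / e <= m%:R.
  by exists (Num.bound (4 / e)); rewrite ltW// archi_boundP// divr_ge0// ltW.
exists (sqrt_iter p m) => v vC; have /andP[p0 p1] := p01 v vC.
have [/andP[q0 qs]] := sqrt_iter_bounds m (p01 v vC).
have s2 := sqr_sqrtr p0.
have s1 : Num.sqrt (mpoly.meval v p) <= 1.
  by rewrite -(@expr_le1 _ 2)// ?sqrtr_ge0// s2.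
move: q0 qs s1 s2; set q := mpoly.meval v (sqrt_iter p m).
move: (Num.sqrt _) => s q0 qs s1 <- h.
have -> : s ^+ 2 - q ^+ 2 = (s - q) * (s + q) by ring.
rewrite ger0_norm; last by nra.
have {}me : 4 <= m%:R * e by rewrite -ler_pdivrMr.
move: (m%:R) (ler0n R m) me h => k k0 ke h.
have [->|sn0] := eqVneq s 0; first by nra.
have sp : 0 < s by rewrite lt_def sn0/=; nra.
have ks : (s - q) * k <= 2.
  by rewrite -(ler_pM2r sp); nra.
have kp : 0 < k by nra.
have : (s - q) * (s + q) * k <= e * k by nra.
by rewrite ler_pM2r.
Qed.

End PolynomialsOnBox.

(** * Polynomial partitions of unity *)

Section PartitionOfUnity.
Variables (R : realType) (n : nat) (C : R).
Hypothesis C0 : 0 < C.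
Implicit Types (v : 'I_n -> R).
Local Notation ev v p := (mpoly.meval v p).

(** The weights are the probabilities of the outcomes of [N] tosses of a coin
    that pays [C] or [- C] with mean [v j]; [s] is the total gain, so the last
    two clauses are its mean and its variance.  Indexing by single outcomes
    instead of the number of heads avoids binomial coefficients. *)
Lemma coin_partition (j : 'I_n) (N : nat) :
  exists (I : finType) (b : I -> mpoly.mpoly n R) (s : I -> R),
  [/\ \sum_i b i = 1,
      forall i v, in_box C v -> 0 <= ev v (b i),
      forall v, \sum_i ev v (b i) * (s i - N%:R * v j) = 0 &
      forall v, \sum_i ev v (b i) * (s i - N%:R * v j) ^+ 2 =
                N%:R * (C ^+ 2 - v j ^+ 2)].
Proof.
elim: N => [|N [I [b [s [b1 b0 m1 m2]]]]].
  exists 'I_1, (fun=> 1), (fun=> 0); split => [|i v _|v|v];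
    rewrite ?big_ord1 ?mpoly.meval1 ?ler01// !mul0r subr0 ?mulr0//.
  by rewrite expr0n mulr0.
pose sg (e : bool) : R := if e then 1 else -1.
(* The value at [v] is [(C + sg e * v j) / (2 C)], the probability of [e]. *)
pose w (e : bool) : mpoly.mpoly n R :=
  mpoly.mpolyC n 2^-1 +
  (sg e / (2 * C)) *: mpoly.mpolyX R (mpoly.mnm1 j).
have evw e v : ev v (w e) = 2^-1 + sg e / (2 * C) * v j.
  by rewrite mpoly.mevalD mpoly.mevalC mpoly.mevalZ mpoly.mevalXU.
have Cn0 : C != 0 by rewrite gt_eqF.
have b1v v : \sum_i ev v (b i) = 1.
  by rewrite -raddf_sum b1; exact: mpoly.meval1.
exists (I * bool)%type, (fun k => b k.1 * w k.2), (fun k => s k.1 + sg k.2 * C).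
split=> [|[i e] v vC|v|v].
- rewrite -(pair_bigA _ (fun i e => b i * w e)) /=.
  under eq_bigr do rewrite -mulr_sumr.
  rewrite -mulr_suml b1 mul1r big_bool /w /= addrACA -scalerDl -mulrDl.
  by rewrite subrr mul0r scale0r addr0 -mpoly.mpolyCD -mpoly.mpolyC1;
     congr mpoly.mpolyC; lra.
- rewrite mpoly.mevalM mulr_ge0 ?b0// evw /=.
  have -> : 2^-1 + sg e / (2 * C) * v j = (C + sg e * v j) / (2 * C) by field.
  rewrite divr_ge0 ?mulr_ge0 ?(ltW C0)//.
  have := vC j; rewrite ler_norml => /andP[].
  by rewrite /sg; case: e; lra.
- rewrite -(pair_bigA _ (fun i e =>
    ev v (b i * w e) * (s i + sg e * C - N.+1%:R * v j))) /=.
  transitivity (\sum_i ev v (b i) * (s i - N%:R * v j)); last exact: m1.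
  apply: eq_bigr => i _; rewrite big_bool /= !mpoly.mevalM !evw /sg -natr1.
  by field.
- rewrite -(pair_bigA _ (fun i e =>
    ev v (b i * w e) * (s i + sg e * C - N.+1%:R * v j) ^+ 2)) /=.
  transitivity (\sum_i (ev v (b i) * (s i - N%:R * v j) ^+ 2 +
       ev v (b i) * (C ^+ 2 - v j ^+ 2))).
    apply: eq_bigr => i _; rewrite big_bool /= !mpoly.mevalM !evw /sg -natr1.
    by field.
  by rewrite big_split /= m2 -mulr_suml b1v mul1r -natr1 mulrDl mul1r.
Qed.

(** The law of large numbers for the average gain, in quadratic mean. *)
Lemma one_variable_partition (j : 'I_n) (d : R) : 0 < d ->
  exists (I : finType) (b : I -> mpoly.mpoly n R) (c : I -> R),
  [/\ \sum_i b i = 1,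
      forall i v, in_box C v -> 0 <= ev v (b i) &
      forall v, in_box C v -> \sum_i ev v (b i) * (c i - v j) ^+ 2 <= d].
Proof.
move=> d0.
have [N Nd] : exists N : nat, C ^+ 2 / d < N%:R.
  by exists (Num.bound (C ^+ 2 / d)); rewrite archi_boundP// divr_ge0
    ?sqr_ge0// ltW.
have N0 : 0 < N%:R :> R by apply: le_lt_trans Nd;
  rewrite divr_ge0 ?sqr_ge0 ?ltW.
have [I [b [s [b1 b0 _ m2]]]] := coin_partition j N.
exists I, b, (fun i => s i / N%:R); split => // v vC.
have -> : \sum_i ev v (b i) * (s i / N%:R - v j) ^+ 2 =
    (\sum_i ev v (b i) * (s i - N%:R * v j) ^+ 2) / N%:R ^+ 2.
  by rewrite mulr_suml; apply: eq_bigr => i _; field; rewrite gt_eqF.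
rewrite ltr_pdivrMr// in Nd.
rewrite m2 ler_pdivrMr ?exprn_gt0// [d * _]mulrC expr2 -mulrA ler_pM2l//.
by apply: (@le_trans _ _ (C ^+ 2)); [rewrite lerBlDr lerDl sqr_ge0|exact: ltW].
Qed.

(** Products of one-variable partitions: summing out the other factors leaves
    the estimate of each single coordinate unchanged. *)
Lemma partition_of_unity (d : R) : 0 < d ->
  exists (I : finType) (b : I -> mpoly.mpoly n R) (c : I -> 'I_n -> R),
  [/\ \sum_i b i = 1,
      forall i v, in_box C v -> 0 <= ev v (b i) &
      forall v, in_box C v -> forall j,
        \sum_i ev v (b i) * (c i j - v j) ^+ 2 <= d].
Proof.
move=> d0.
suff H : forall r : seq 'I_n,
    exists (I : finType) (b : I -> mpoly.mpoly n R) (c : I -> 'I_n -> R),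
  [/\ \sum_i b i = 1,
      forall i v, in_box C v -> 0 <= ev v (b i) &
      forall v, in_box C v -> forall j, j \in r ->
        \sum_i ev v (b i) * (c i j - v j) ^+ 2 <= d].
  have [I [b [c [b1 b0 bd]]]] := H (enum 'I_n).
  by exists I, b, c; split => // v vC j; apply: bd; rewrite ?mem_enum.
elim=> [|k r [I [b [c [b1 b0 bd]]]]].
  by exists 'I_1, (fun=> 1), (fun _ _ => 0); split => // [|i v _];
    rewrite ?big_ord1 ?mpoly.meval1.
have [I' [b' [c' [b1' b0' bd']]]] := one_variable_partition k d0.
exists (I * I')%type, (fun i => b i.1 * b' i.2),
  (fun i j => if j == k then c' i.2 else c i.1 j).
split=> [|[i i'] v vC|v vC j].
- rewrite -(pair_bigA _ (fun i i' => b i * b' i')) /=.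
  by under eq_bigr do rewrite -mulr_sumr b1' mulr1.
- by rewrite mpoly.mevalM mulr_ge0 ?b0 ?b0'.
- rewrite -(pair_bigA _ (fun i i' => ev v (b i * b' i') *
     ((if j == k then c' i' else c i j) - v j) ^+ 2)) /=.
  have sumv (J : finType) (a : J -> mpoly.mpoly n R) : \sum_i a i = 1 ->
      \sum_i ev v (a i) = 1 by move=> a1; rewrite -raddf_sum a1;
        exact: mpoly.meval1.
  have [->{j} _|jk] := eqVneq j k.
    rewrite exchange_big /=; apply: le_trans (bd' v vC).
    rewrite ler_sum// => i' _.
    under eq_bigr do rewrite mpoly.mevalM -mulrA.
    by rewrite -mulr_suml sumv// mul1r.
  rewrite inE (negbTE jk) /= => jr; apply: le_trans (bd v vC j jr).
  rewrite ler_sum// => i _.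
  under eq_bigr do rewrite mpoly.mevalM mulrAC.
  by rewrite -mulr_sumr sumv// mulr1.
Qed.

End PartitionOfUnity.

(** * Bounded measurable functions *)

Section BoundedMeasurable.
Context {d : measure_display} {T : measurableType d} {R : realType}.
Implicit Types (f g : T -> R) (P : probability T R).

Definition bounded_mfun f :=
  measurable_fun setT f /\ exists K : R, forall x, `|f x| <= K.

Lemma bounded_mfun_cst (c : R) : bounded_mfun (fun=> c).
Proof. by split; [exact: measurable_cst|exists `|c|]. Qed.

Lemma bounded_mfunD f g : bounded_mfun f -> bounded_mfun g ->
  bounded_mfun (fun x => f x + g x).
Proof.
move=> [mf [K fK]] [mg [L gL]]; split; first exact: measurable_funD.
by exists (K + L) => x; apply: le_trans (ler_normD _ _) _; apply: lerD.
Qed.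

Lemma bounded_mfunM f g : bounded_mfun f -> bounded_mfun g ->
  bounded_mfun (fun x => f x * g x).
Proof.
move=> [mf [K fK]] [mg [L gL]]; split; first exact: measurable_funM.
by exists (K * L) => x; rewrite normrM ler_pM.
Qed.

Lemma bounded_mfunZ (c : R) f : bounded_mfun f ->
  bounded_mfun (fun x => c * f x).
Proof. exact: bounded_mfunM (bounded_mfun_cst c). Qed.

Lemma bounded_mfunN f : bounded_mfun f -> bounded_mfun (fun x => - f x).
Proof. by move=> /(bounded_mfunZ (-1)); under eq_fun do rewrite mulN1r. Qed.

Lemma bounded_mfunB f g : bounded_mfun f -> bounded_mfun g ->
  bounded_mfun (fun x => f x - g x).
Proof. by move=> bf /bounded_mfunN; exact: bounded_mfunD. Qed.

Lemma bounded_mfun_sum (I : Type) (r : seq I) (F : I -> T -> R) :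
  (forall i, bounded_mfun (F i)) ->
  bounded_mfun (fun x => \sum_(i <- r) F i x).
Proof.
move=> bF; elim: r => [|i r ih].
  by under eq_fun do rewrite big_nil; exact: bounded_mfun_cst.
by under eq_fun do rewrite big_cons; exact: bounded_mfunD.
Qed.

Lemma bounded_mfun_indic (A : set T) : measurable A -> bounded_mfun \1_A.
Proof.
move=> mA; split; first exact: measurable_indic.
by exists 1 => x; rewrite indicE; case: (x \in A); rewrite ?normr1 ?normr0.
Qed.

(** Completeness of the space of bounded measurable functions. *)
Lemma bounded_mfun_uniform_limit (u : nat -> T -> R) :
  (forall m, bounded_mfun (u m)) ->
  (forall e : R, 0 < e -> exists N, forall m k, (N <= m)%N -> (N <= k)%N ->
     forall x, `|u m x - u k x| <= e) ->
  exists l : T -> R, bounded_mfun l /\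
    forall e : R, 0 < e -> exists N, forall m, (N <= m)%N ->
      forall x, `|u m x - l x| <= e.
Proof.
move=> bu cu.
have cvgu x : cvgn (fun m => u m x).
  apply: cauchy_cvg; apply: cauchy_exP => e e0.
  have e20 : 0 < e / 2 by rewrite divr_gt0.
  have [N HN] := cu _ e20.
  exists (u N x); exists N => // m /= Nm; rewrite /ball /=.
  by apply: le_lt_trans (HN _ _ (leqnn N) Nm x) _;
    rewrite ltr_pdivrMr// ltr_pMr// ltr1n.
pose l x := limn (fun m => u m x).
have lu (e : R) : 0 < e -> exists N, forall m, (N <= m)%N ->
    forall x, `|u m x - l x| <= e.
  move=> e0; have [N HN] := cu _ e0; exists N => m Nm x.
  have cv : (fun k => `|u m x - u k x|) @ \oo --> `|u m x - l x|.
    by apply: cvg_norm; apply: cvgB; [exact: cvg_cst|exact: cvgu].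
  apply: (@closed_cvg _ _ _ eventually_filter _ (fun y => y <= e) _ _ _ cv).
    exact: closed_le.
  by exists N => // k /= Nk; exact: HN.
exists l; split => //; split.
  by apply: (@measurable_fun_cvg _ _ _ _ u) => [m|x _];
    [exact: (bu m).1|exact: cvgu].
have [N HN] := lu 1 ltr01; have [_ [K uK]] := bu N.
exists (1 + K) => x; rewrite -[l x](subKr (u N x)).
apply: le_trans (ler_normB _ _) _.
by rewrite addrC; apply: lerD; [exact: HN|exact: uK].
Qed.

Lemma bounded_mfun_integrable P f : bounded_mfun f ->
  P.-integrable setT (EFin \o f).
Proof.
move=> [mf [K fK]]; apply: measurable_bounded_integrable => //.
  exact: le_lt_trans (probability_le1 P measurableT) (ltry _).
exists K; split; first exact: num_real.
by move=> x Kx y _; exact: le_trans (fK y) (ltW Kx).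
Qed.

Lemma Rintegral_prob_cst P (c : R) : \int[P]_x c = c.
Proof.
rewrite Rintegral_cst// [X in fine X](_ : _ = 1%E) ?mulr1//.
exact: probability_setT.
Qed.

Lemma Rintegral_sum P (I : Type) (r : seq I) (F : I -> T -> R) :
  (forall i, bounded_mfun (F i)) ->
  \int[P]_x (\sum_(i <- r) F i x) = \sum_(i <- r) \int[P]_x F i x.
Proof.
move=> bF; elim: r => [|i r ih].
  rewrite big_nil; under eq_Rintegral do rewrite big_nil.
  exact: Rintegral_prob_cst.
rewrite big_cons; under eq_Rintegral do rewrite big_cons.
rewrite RintegralD ?ih//; apply: bounded_mfun_integrable => //.
exact: bounded_mfun_sum.
Qed.

Lemma integral_bounded_mfun P f : bounded_mfun f ->
  (\int[P]_x (f x)%:E = (\int[P]_x f x)%:E)%E.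
Proof.
by move=> bf; rewrite /Rintegral fineK//; apply: integrable_fin_num => //;
  exact: bounded_mfun_integrable.
Qed.

Lemma Rintegral_indicE P (A : set T) : measurable A ->
  P A = (\int[P]_x \1_A x)%:E.
Proof.
move=> mA; rewrite -integral_bounded_mfun; last exact: bounded_mfun_indic.
by rewrite integral_indic// setIT.
Qed.

End BoundedMeasurable.

(** * Probability measures with a bounded density *)

Section Density.
Context {d : measure_display} {T : measurableType d} {R : realType}.
Variables (P : probability T R) (h : T -> R).
Hypotheses (h_bm : bounded_mfun h) (h_ge0 : forall x, 0 <= h x).
Hypothesis h1 : \int[P]_x h x = 1.

Definition density_mass (A : set T) : \bar R := (\int[P]_(x in A) (h x)%:E)%E.

Let mh : measurable_fun setT (EFin \o h).
Proof. by apply/measurable_EFinP; exact: h_bm.1. Qed.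

Let density_mass0 : density_mass set0 = 0%E.
Proof. by rewrite /density_mass integral_set0. Qed.

Let density_mass_ge0 A : (0 <= density_mass A)%E.
Proof. by apply: integral_ge0 => x _; rewrite lee_fin. Qed.

Let density_mass_sigma_additive : semi_sigma_additive density_mass.
Proof.
move=> /= F mF tF mUF; rewrite /density_mass; apply: cvg_toP.
  apply: ereal_nondecreasing_is_cvgn => m k mk.
  apply: lee_sum_nneg_natr => // i _ _; apply: integral_ge0 => /= x _.
  by rewrite lee_fin.
rewrite ge0_integral_bigcup//=.
- exact/measurable_funTS.
- by move=> x _; rewrite lee_fin.
Qed.

HB.instance Definition _ := isMeasure.Build _ _ _ density_mass
  density_mass0 density_mass_ge0 density_mass_sigma_additive.

Let density_massT : density_mass setT = 1%E.
Proof. by rewrite /density_mass integral_bounded_mfun// h1. Qed.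

HB.instance Definition _ :=
  Measure_isProbability.Build _ _ _ density_mass density_massT.

Lemma density_dominated : density_mass `<< P.
Proof.
apply/null_content_dominatesP => A mA PA0; rewrite /density_mass.
by apply: null_set_integral => //; exact/measurable_funTS.
Qed.

(** The Radon-Nikodym change of variables, [h] being a derivative of
    [density_mass] by uniqueness. *)
Lemma Rintegral_density (f : T -> R) : bounded_mfun f ->
  \int[density_mass]_x f x = \int[P]_x (f x * h x).
Proof.
move=> bf; congr fine.
rewrite -(Radon_Nikodym_change_of_variables density_dominated)//=; last first.
  exact: bounded_mfun_integrable.
have dom : charge_of_finite_measure density_mass `<< P := density_dominated.
have mRN := Radon_Nikodym_integrable dom.
apply: ae_eq_integral => //.
- apply: emeasurable_funM => //; first by apply/measurable_EFinP; exact: bf.1.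
- by apply/measurable_EFinP; exact: (bounded_mfunM bf h_bm).1.
- under [X in ae_eq _ _ _ X]eq_fun do rewrite EFinM.
  apply: ae_eqe_mul2l => /=.
  apply: integral_ae_eq => //= E _ mE.
  by rewrite -Radon_Nikodym_integral.
Qed.

Lemma density_probability : exists Q : probability T R,
  forall f, bounded_mfun f -> \int[Q]_x f x = \int[P]_x (f x * h x).
Proof. by exists density_mass; exact: Rintegral_density. Qed.

End Density.

Section ProductIntegral.
Context {d1 d2 : measure_display} {T1 : measurableType d1}
  {T2 : measurableType d2} {R : realType}.

Lemma bounded_mfun_fst (f : T1 -> R) : bounded_mfun f ->
  bounded_mfun (fun z : T1 * T2 => f z.1).
Proof.
move=> [mf [K fK]]; split; last by exists K => z; exact: fK.
by apply: measurableT_comp => //; exact: measurable_fst.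
Qed.

Lemma bounded_mfun_snd (f : T2 -> R) : bounded_mfun f ->
  bounded_mfun (fun z : T1 * T2 => f z.2).
Proof.
move=> [mf [K fK]]; split; last by exists K => z; exact: fK.
by apply: measurableT_comp => //; exact: measurable_snd.
Qed.

Lemma Rintegral_prod (P1 : probability T1 R) (P2 : probability T2 R) f g :
  bounded_mfun f -> bounded_mfun g ->
  \int[(P1 \x P2)%E]_z (f z.1 * g z.2) = (\int[P1]_x f x) * \int[P2]_y g y.
Proof.
move=> bf bg; rewrite {1}/Rintegral -integral12_prod_meas1; last first.
  apply: (bounded_mfun_integrable (P1 \x P2)%E).
  exact: bounded_mfunM (bounded_mfun_fst bf) (bounded_mfun_snd bg).
rewrite /fubini_F /=.
under eq_integral => x _.
  rewrite (integral_bounded_mfun P2); last exact: bounded_mfunZ.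
  rewrite RintegralZl//; last exact: bounded_mfun_integrable.
  over.
rewrite -RintegralZr//; exact: bounded_mfun_integrable.
Qed.

End ProductIntegral.

(** * Polynomials cut off to a box *)

Section BoxedPolynomials.
Variables (R : realType) (n : nat) (C : R).
Implicit Types (p q : mpoly.mpoly n R) (v : 'I_n -> R).

Lemma meval_bounded_on_box p : 0 <= C ->
  exists K, forall v, in_box C v -> `|mpoly.meval v p| <= K.
Proof.
move=> C0; elim/mpoly.mpolyind: p => [|c m p _ _ [K Kp]].
  by exists 0 => v _; rewrite mpoly.meval0 normr0.
exists (`|c| * \prod_(i < n) C ^+ m i + K) => v vC.
rewrite mpoly.mevalD; apply: le_trans (ler_normD _ _) _; apply: lerD;
  last exact: Kp.
rewrite mpoly.mevalZ mpoly.mevalX normrM ler_wpM2l// normr_prod.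
apply: ler_prod => i _; rewrite normr_ge0 normrX.
by apply: lerXn2r; rewrite ?nnegrE.
Qed.

Definition box : set (n.-tuple R) := [set x | in_box C (tnth x)].

Lemma measurable_box : measurable box.
Proof.
have -> : box = \big[setI/setT]_(j <- enum 'I_n)
    ((fun x : n.-tuple R => tnth x j) @^-1` `[- C, C]).
  rewrite predeqE => x; split=> [xC|].
    by elim/big_ind: _ => //= j _; rewrite in_itv /= -ler_norml.
  rewrite -bigcap_seq => xC j; have := xC j.
  by rewrite /= mem_enum in_itv /= -ler_norml; exact.
apply: bigsetI_measurable => j _; rewrite -[_ @^-1` _]setTI.
by apply: measurable_tnth => //; exact: measurable_itv.
Qed.

Lemma measurable_meval p :
  measurable_fun setT (fun x : n.-tuple R => mpoly.meval (tnth x) p).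
Proof.
under eq_fun do rewrite mpoly.mevalE.
apply: measurable_sum => m; apply: measurable_funM; first exact: measurable_cst.
by apply: measurable_prod => i _; apply: measurable_funX;
  exact: measurable_tnth.
Qed.

(** Polynomials are unbounded, so that only their cut-offs are integrable
    against every probability measure; a measure carried by the box does not
    see the difference. *)
Definition boxed p (x : n.-tuple R) : R := \1_box x * mpoly.meval (tnth x) p.

Lemma boxedE p x : in_box C (tnth x) -> boxed p x = mpoly.meval (tnth x) p.
Proof. by move=> xC; rewrite /boxed indicE mem_set// mul1r. Qed.

Lemma boxed0 p x : ~ in_box C (tnth x) -> boxed p x = 0.
Proof. by move=> xC; rewrite /boxed indicE memNset// mul0r. Qed.

Lemma boxedM p q x : boxed (p * q) x = boxed p x * boxed q x.
Proof.
have [xC|xC] := pselect (in_box C (tnth x)).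
  by rewrite !boxedE// mpoly.mevalM.
by rewrite !boxed0// mul0r.
Qed.

Lemma boxedD p q x : boxed (p + q) x = boxed p x + boxed q x.
Proof. by rewrite /boxed mpoly.mevalD mulrDr. Qed.

Lemma boxedZ c p x : boxed (c *: p) x = c * boxed p x.
Proof. by rewrite /boxed mpoly.mevalZ mulrCA. Qed.

Lemma boxed_ge0 q x : (forall v, in_box C v -> 0 <= mpoly.meval v q) ->
  0 <= boxed q x.
Proof.
move=> q0; have [xC|xC] := pselect (in_box C (tnth x)).
  by rewrite boxedE// q0.
by rewrite boxed0.
Qed.

Lemma bounded_mfun_boxed p : 0 <= C -> bounded_mfun (boxed p).
Proof.
move=> C0; split.
  apply: measurable_funM; last exact: measurable_meval.
  by apply: measurable_indic; exact: measurable_box.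
have [K Kp] := meval_bounded_on_box p C0.
exists `|K| => x; have [xC|xC] := pselect (in_box C (tnth x)).
  by rewrite boxedE//; apply: le_trans (Kp _ xC) _; exact: ler_norm.
by rewrite boxed0// normr0.
Qed.

End BoxedPolynomials.

(** Coordinates are bounded on a compact set.  Every larger box also carries
    the measure, which lets two measures share a box. *)
Lemma compactly_supported_box (R : realType) (n : nat)
    (mu : probability (n.-tuple R) R) : compactly_supported mu ->
  exists C0 : R, forall C, C0 <= C -> {ae mu, forall x, in_box C (tnth x)}.
Proof.
move=> [K [cK nK]].
have bK (j : 'I_n) : exists c : R, forall u : 'rV[R]_n, K u -> `|u ord0 j| <= c.
  pose f (u : 'rV[R]_n) := u ord0 j.
  have cf : compact (f @` K).
    apply: continuous_compact => //; apply: continuous_subspaceT.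
    exact: coord_continuous.
  have [c [_ Hc]] := compact_bounded cf.
  by exists (c + 1) => u Ku; apply: (Hc (c + 1)); [rewrite ltrDl|exists u].
pose c j := sval (cid (bK j)).
have cP j u : K u -> `|u ord0 j| <= c j by exact: (svalP (cid (bK j))).
exists (\sum_j `|c j|) => C cC.
apply: negligibleS nK => x /= xC Kx; apply: xC => j.
have := cP j _ Kx; rewrite mxE => /le_trans; apply; apply: le_trans cC.
rewrite (bigD1 j)//=; apply: le_trans (ler_norm _) _.
by rewrite lerDl sumr_ge0.
Qed.

Section PolynomialMoments.
Variables (R : realType) (n : nat) (C : R).
Hypothesis C0 : 0 <= C.
Variable mu : probability (n.-tuple R) R.
Hypothesis mu_box : {ae mu, forall x, in_box C (tnth x)}.
Implicit Types (p q : mpoly.mpoly n R).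

Lemma Rintegral_boxed p :
  \int[mu]_x mpoly.meval (tnth x) p = \int[mu]_x boxed C p x.
Proof.
congr fine; apply: ae_eq_integral => //.
- by apply/measurable_EFinP; exact: measurable_meval.
- by apply/measurable_EFinP; exact: (bounded_mfun_boxed p C0).1.
- by apply: filterS mu_box => x xC _; rewrite boxedE.
Qed.

Definition moment p := \int[mu]_x boxed C p x.

Lemma tau_moment (M : tracialSpace R) (Z : 'I_n -> M) p :
  is_distribution Z mu -> tau M (poly_calc Z p) = (moment p)%:C.
Proof.
by move=> [_ Z_mu]; rewrite /moment -Rintegral_boxed; exact: Z_mu.
Qed.

Lemma momentD p q : moment (p + q) = moment p + moment q.
Proof.
rewrite /moment -RintegralD//; try by apply: bounded_mfun_integrable;
  exact: bounded_mfun_boxed.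
by apply: eq_Rintegral => x _; rewrite boxedD.
Qed.

Lemma momentZ c p : moment (c *: p) = c * moment p.
Proof.
rewrite /moment -RintegralZl//; last by apply: bounded_mfun_integrable;
  exact: bounded_mfun_boxed.
by apply: eq_Rintegral => x _; rewrite boxedZ.
Qed.

Lemma moment1 : moment 1 = 1.
Proof.
rewrite /moment -Rintegral_boxed; under eq_Rintegral do rewrite mpoly.meval1.
exact: Rintegral_prob_cst.
Qed.

Lemma moment_ge0 p : (forall v, in_box C v -> 0 <= mpoly.meval v p) ->
  0 <= moment p.
Proof.
by move=> p0; apply: Rintegral_ge0 => x _; exact: boxed_ge0.
Qed.

Lemma le_moment p q :
  (forall v, in_box C v -> mpoly.meval v p <= mpoly.meval v q) ->
  moment p <= moment q.
Proof.
move=> pq; rewrite -subr_ge0.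
have -> : moment q - moment p = moment (q - p).
  by rewrite momentD -(scaleN1r p) momentZ mulN1r.
by apply: moment_ge0 => v vC; rewrite mpoly.mevalB subr_ge0 pq.
Qed.

Lemma moment_sum (I : Type) (r : seq I) (F : I -> mpoly.mpoly n R) :
  moment (\sum_(i <- r) F i) = \sum_(i <- r) moment (F i).
Proof.
elim: r => [|i r ih]; last by rewrite !big_cons momentD ih.
by rewrite !big_nil -(scale0r (1 : mpoly.mpoly n R)) momentZ mul0r.
Qed.

Lemma moment_square_le p (s : R) :
  (forall v, in_box C v -> `|mpoly.meval v p| <= s) ->
  moment (p * p) <= s ^+ 2.
Proof.
move=> ps; have -> : s ^+ 2 = moment ((s ^+ 2) *: 1).
  by rewrite momentZ moment1 mulr1.
apply: le_moment => v vC.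
rewrite mpoly.mevalM mpoly.mevalZ mpoly.meval1 mulr1 -expr2.
rewrite -(real_normK (num_real (mpoly.meval v p))).
by apply: lerXn2r; rewrite ?nnegrE ?ps//; apply: le_trans (ps v vC).
Qed.

End PolynomialMoments.

(** * Marginals and cost of a coupling *)

Section CouplingMarginals.
Variables (R : realType) (n : nat).
Variables (mu nu : probability (n.-tuple R) R).
Variable pi : probability (n.-tuple R * n.-tuple R)%type R.
Hypothesis mn_pi : coupling mu nu pi.

Lemma Rintegral_coupling_fst (f : n.-tuple R -> R) : bounded_mfun f ->
  \int[pi]_z f z.1 = \int[mu]_x f x.
Proof.
move=> bf; congr fine.
transitivity (\int[pushforward pi fst]_x (f x)%:E)%E.
  rewrite integral_pushforward//; first by apply/measurable_EFinP; exact: bf.1.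
  rewrite preimage_setT.
  exact: (bounded_mfun_integrable pi (bounded_mfun_fst bf)).
apply: eq_measure_integral => A mA _; rewrite /pushforward.
transitivity (pi (A `*` setT)); last exact: (mn_pi mA).1.
by congr (pi _); apply/seteqP; split=> z //= [].
Qed.

Lemma Rintegral_coupling_snd (g : n.-tuple R -> R) : bounded_mfun g ->
  \int[pi]_z g z.2 = \int[nu]_x g x.
Proof.
move=> bg; congr fine.
transitivity (\int[pushforward pi snd]_x (g x)%:E)%E.
  rewrite integral_pushforward//; first by apply/measurable_EFinP; exact: bg.1.
  rewrite preimage_setT.
  exact: (bounded_mfun_integrable pi (bounded_mfun_snd bg)).
apply: eq_measure_integral => A mA _; rewrite /pushforward.
transitivity (pi (setT `*` A)); last exact: (mn_pi mA).2.
by congr (pi _); apply/seteqP; split=> z //= [].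
Qed.

Variable C : R.
Hypothesis C0 : 0 <= C.
Hypothesis mu_box : {ae mu, forall x, in_box C (tnth x)}.
Hypothesis nu_box : {ae nu, forall x, in_box C (tnth x)}.

Lemma coupling_ae_box :
  {ae pi, forall z, in_box C (tnth z.1) /\ in_box C (tnth z.2)}.
Proof.
have ae1 : {ae pi, forall z, in_box C (tnth z.1)}.
  have [A [mA A0 bA]] := mu_box.
  exists (A `*` setT); split; first exact: measurableX.
    exact: (etrans (mn_pi mA).1 A0).
  by move=> z /= zC; split => //; apply: bA.
have ae2 : {ae pi, forall z, in_box C (tnth z.2)}.
  have [A [mA A0 bA]] := nu_box.
  exists (setT `*` A); split; first exact: measurableX.
    exact: (etrans (mn_pi mA).2 A0).
  by move=> z /= zC; split => //; apply: bA.
by apply: filterS2 ae1 ae2.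
Qed.

Local Notation coord j := (mpoly.mpolyX R (mpoly.mnm1 j)).

(** Expanding the square leaves only one term that depends on the coupling,
    the mixed moment of the coordinates. *)
Lemma coupling_cost :
  (\int[pi]_z (\sum_(j < n) (tnth z.1 j - tnth z.2 j) ^+ 2)%:E =
   (\sum_(j < n) (moment C mu (coord j ^+ 2) + moment C nu (coord j ^+ 2) -
      2 * \int[pi]_z (boxed C (coord j) z.1 * boxed C (coord j) z.2)))%:E)%E.
Proof.
have bm1 p : bounded_mfun (fun z : n.-tuple R * n.-tuple R => boxed C p z.1).
  by apply: bounded_mfun_fst; exact: bounded_mfun_boxed.
have bm2 p : bounded_mfun (fun z : n.-tuple R * n.-tuple R => boxed C p z.2).
  by apply: bounded_mfun_snd; exact: bounded_mfun_boxed.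
pose F j (z : n.-tuple R * n.-tuple R) : R :=
  boxed C (coord j ^+ 2) z.1 + boxed C (coord j ^+ 2) z.2 -
  2 * (boxed C (coord j) z.1 * boxed C (coord j) z.2).
have bF j : bounded_mfun (F j).
  apply: bounded_mfunB; first exact: bounded_mfunD.
  by apply: bounded_mfunZ; exact: bounded_mfunM.
transitivity (\int[pi]_z (\sum_(j < n) F j z)%:E)%E.
  apply: ae_eq_integral => //.
  - apply/measurable_EFinP; apply: measurable_sum => j.
    apply: measurable_funX; apply: measurable_funB.
      exact: (measurableT_comp (measurable_tnth j) measurable_fst).
    exact: (measurableT_comp (measurable_tnth j) measurable_snd).
  - by apply/measurable_EFinP; exact: (bounded_mfun_sum _ bF).1.
  - apply: filterS coupling_ae_box => z [z1 z2] _ /=; congr (_%:E).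
    apply: eq_bigr => j _; rewrite /F !boxedE// !mpoly.mevalM !mpoly.mevalXU.
    ring.
rewrite integral_bounded_mfun; last exact: bounded_mfun_sum.
rewrite Rintegral_sum//; congr (_%:E); apply: eq_bigr => j _.
rewrite /F RintegralB//; try exact: bounded_mfun_integrable; last 2 first.
- by apply: bounded_mfun_integrable; exact: bounded_mfunD.
- by apply: bounded_mfun_integrable; apply: bounded_mfunZ; exact: bounded_mfunM.
rewrite RintegralD//; try exact: bounded_mfun_integrable.
rewrite RintegralZl//; last by apply: bounded_mfun_integrable;
  exact: bounded_mfunM.
by rewrite Rintegral_coupling_fst ?Rintegral_coupling_snd//;
  exact: bounded_mfun_boxed.
Qed.

End CouplingMarginals.

(** * Couplings from nonnegative weights *)

(** The marginal computation behind [coupling_from_weights].  With the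
    convention [x / 0 = 0] the terms of an empty row or column vanish on both
    sides, so that empty cells are not a separate case. *)
Lemma weighted_row_sum (R : realType) (I J : finType) (p : I -> J -> R)
    (F : I -> R) :
  (forall i j, 0 <= p i j) ->
  (forall i, \sum_j p i j = 0 -> F i = 0) ->
  \sum_i \sum_j p i j / ((\sum_j' p i j') * \sum_i' p i' j) *
     (F i * \sum_i' p i' j) = \sum_i F i.
Proof.
move=> p0 F0; apply: eq_bigr => i _.
have [m0|mn0] := eqVneq (\sum_j p i j) 0.
  by rewrite F0// big1// => j _; rewrite mul0r mulr0.
transitivity (\sum_j p i j * (F i / \sum_j' p i j')); last first.
  by rewrite -mulr_suml mulrCA divff// mulr1.
apply: eq_bigr => j _.
have [n0|nn0] := eqVneq (\sum_i' p i' j) 0; last first.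
  move: (\sum_j' p i j') (\sum_i' p i' j) mn0 nn0 => a e a0 e0.
  by field; rewrite a0 e0.
have -> : p i j = 0; last by rewrite !mul0r.
have /eqP := n0; rewrite psumr_eq0// => /allP /(_ i).
by rewrite mem_index_enum => /(_ isT)/eqP.
Qed.

Section PartitionMoments.
Variables (R : realType) (n : nat) (C : R).
Hypothesis C0 : 0 <= C.

Lemma Rintegral_partition (K : finType) (a : K -> mpoly.mpoly n R)
    (la : probability (n.-tuple R) R) (f : n.-tuple R -> R) :
  {ae la, forall x, in_box C (tnth x)} -> bounded_mfun f -> \sum_k a k = 1 ->
  \sum_k \int[la]_x (f x * boxed C (a k) x) = \int[la]_x f x.
Proof.
move=> la_box bf a1.
have bfa k : bounded_mfun (fun x => f x * boxed C (a k) x).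
  by apply: bounded_mfunM => //; exact: bounded_mfun_boxed.
rewrite -Rintegral_sum//; congr fine; apply: ae_eq_integral => //.
- by apply/measurable_EFinP; exact: (bounded_mfun_sum _ bfa).1.
- by apply/measurable_EFinP; exact: bf.1.
- apply: filterS la_box => x xC _; congr (_%:E).
  under eq_bigr do rewrite boxedE//.
  by rewrite -mulr_sumr -raddf_sum a1 /= mpoly.meval1 mulr1.
Qed.

Lemma moment_eq0_Rintegral (la : probability (n.-tuple R) R)
    (q : mpoly.mpoly n R) (f : n.-tuple R -> R) :
  (forall v, in_box C v -> 0 <= mpoly.meval v q) -> bounded_mfun f ->
  moment C la q = 0 -> \int[la]_x (f x * boxed C q x) = 0.
Proof.
move=> q0 [mf [K fK]] lq0.
have bq := bounded_mfun_boxed q C0.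
have bfq : bounded_mfun (fun x => f x * boxed C q x).
  by apply: bounded_mfunM => //; split => //; exists K.
apply/eqP; rewrite -normr_le0.
apply: le_trans
  (le_normr_Rintegral measurableT (bounded_mfun_integrable la bfq)) _.
suff: \int[la]_x `|f x * boxed C q x| <= \int[la]_x (K * boxed C q x).
  rewrite RintegralZl//; last exact: bounded_mfun_integrable.
  by rewrite -/(moment C la q) lq0 mulr0.
apply: le_Rintegral => //.
- apply: bounded_mfun_integrable; split.
    by apply: measurableT_comp => //; exact: bfq.1.
  by have [K' K'P] := bfq.2; exists K' => x; rewrite normr_id.
- by apply: bounded_mfun_integrable; exact: bounded_mfunZ.
- move=> x _; rewrite normrM (ger0_norm (boxed_ge0 x q0)).
  by rewrite ler_wpM2r// boxed_ge0.
Qed.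

End PartitionMoments.

Section CouplingFromWeights.
Variables (R : realType) (n : nat) (C : R).
Hypothesis C0 : 0 <= C.
Variables (mu nu : probability (n.-tuple R) R).
Hypothesis mu_box : {ae mu, forall x, in_box C (tnth x)}.
Hypothesis nu_box : {ae nu, forall x, in_box C (tnth x)}.
Variables (I J : finType) (b : I -> mpoly.mpoly n R) (c : J -> mpoly.mpoly n R).
Hypotheses (b1 : \sum_i b i = 1) (c1 : \sum_j c j = 1).
Hypothesis b_ge0 : forall i v, in_box C v -> 0 <= mpoly.meval v (b i).
Hypothesis c_ge0 : forall j v, in_box C v -> 0 <= mpoly.meval v (c j).
Variable p : I -> J -> R.
Hypothesis p_ge0 : forall i j, 0 <= p i j.
Hypothesis p_row : forall i, \sum_j p i j = moment C mu (b i).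
Hypothesis p_col : forall j, \sum_i p i j = moment C nu (c j).

(** On the cell [(i, j)] the coupling is [p i j] times the product of the laws
    of [mu] and [nu] conditioned on the cells [i] and [j].  As a density with
    respect to [mu \x nu] it is the function [h] of the proof; the conditions
    on the row and column sums of [p] give the marginals. *)
Lemma coupling_from_weights :
  exists2 pi : probability (n.-tuple R * n.-tuple R)%type R,
    coupling mu nu pi &
    forall f g, bounded_mfun f -> bounded_mfun g ->
      \int[pi]_z (f z.1 * g z.2) =
      \sum_i \sum_j p i j / (moment C mu (b i) * moment C nu (c j)) *
        ((\int[mu]_x (f x * boxed C (b i) x)) *
         (\int[nu]_x (g x * boxed C (c j) x))).
Proof.
pose w i j := p i j / (moment C mu (b i) * moment C nu (c j)).
pose T2 := (n.-tuple R * n.-tuple R)%type.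
pose h (z : T2) : R :=
  \sum_i \sum_j w i j * (boxed C (b i) z.1 * boxed C (c j) z.2).
have bb (q : mpoly.mpoly n R) := bounded_mfun_boxed q C0.
have bh0 i j : bounded_mfun
    (fun z : T2 => w i j * (boxed C (b i) z.1 * boxed C (c j) z.2)).
  by apply/bounded_mfunZ/bounded_mfunM;
    [exact: bounded_mfun_fst|exact: bounded_mfun_snd].
have bh : bounded_mfun h.
  by apply: bounded_mfun_sum => i; apply: bounded_mfun_sum => j.
have h_ge0 z : 0 <= h z.
  apply: sumr_ge0 => i _; apply: sumr_ge0 => j _; rewrite mulr_ge0//.
    apply: divr_ge0 => //; apply: mulr_ge0; apply: moment_ge0 => v.
      exact: b_ge0.
    exact: c_ge0.
  by apply: mulr_ge0; apply: boxed_ge0 => v; [exact: b_ge0|exact: c_ge0].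
pose Q f g := \sum_i \sum_j w i j *
  ((\int[mu]_x (f x * boxed C (b i) x)) * (\int[nu]_x (g x * boxed C (c j) x))).
have QE f g : bounded_mfun f -> bounded_mfun g ->
    \int[(mu \x nu)%E]_z (f z.1 * g z.2 * h z) = Q f g.
  move=> bf bg.
  pose G i j (z : T2) := w i j *
    ((f z.1 * boxed C (b i) z.1) * (g z.2 * boxed C (c j) z.2)).
  have bfb i : bounded_mfun (fun x => f x * boxed C (b i) x)
    by exact: bounded_mfunM bf (bb _).
  have bgc j : bounded_mfun (fun x => g x * boxed C (c j) x)
    by exact: bounded_mfunM bg (bb _).
  have bG' i j : bounded_mfun (fun z : T2 =>
      (f z.1 * boxed C (b i) z.1) * (g z.2 * boxed C (c j) z.2)).
    exact: bounded_mfunM (bounded_mfun_fst (bfb i)) (bounded_mfun_snd (bgc j)).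
  have bG i j : bounded_mfun (G i j) by exact: bounded_mfunZ.
  transitivity (\int[(mu \x nu)%E]_z (\sum_i \sum_j G i j z)).
    apply: eq_Rintegral => z _; rewrite /h mulr_sumr; apply: eq_bigr => i _.
    by rewrite mulr_sumr; apply: eq_bigr => j _; rewrite /G; ring.
  rewrite (Rintegral_sum (mu \x nu)%E); last by move=> i;
    exact: bounded_mfun_sum.
  apply: eq_bigr => i _; rewrite (Rintegral_sum (mu \x nu)%E)//.
  apply: eq_bigr => j _; rewrite RintegralZl//; last first.
    exact: (bounded_mfun_integrable (mu \x nu)%E).
  by rewrite (Rintegral_prod mu nu (bfb i) (bgc j)).
have one_moment (la : probability (n.-tuple R) R) q :
    \int[la]_x (cst 1 x * boxed C q x) = moment C la q.
  by apply: eq_Rintegral => x _; rewrite /= mul1r.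
have Q1 f : bounded_mfun f -> Q f (cst 1) = \int[mu]_x f x.
  move=> bf; rewrite -(Rintegral_partition C0 mu_box bf b1).
  rewrite -(weighted_row_sum p_ge0) => [|i]; last first.
    by rewrite p_row; apply: moment_eq0_Rintegral => // v; exact: b_ge0.
  by apply: eq_bigr => i _; apply: eq_bigr => j _;
    rewrite one_moment p_row p_col.
have Q2 g : bounded_mfun g -> Q (cst 1) g = \int[nu]_x g x.
  move=> bg; rewrite -(Rintegral_partition C0 nu_box bg c1).
  rewrite -(@weighted_row_sum _ _ _ (fun j i => p i j)) => [|//|j]; last first.
    by rewrite p_col; apply: moment_eq0_Rintegral => // v; exact: c_ge0.
  rewrite /Q exchange_big /=.
  apply: eq_bigr => j _; apply: eq_bigr => i _;
    rewrite one_moment p_row p_col /w.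
  by rewrite [X in _ / X]mulrC [X in _ * X]mulrC.
have bm1 := bounded_mfun_cst (T := n.-tuple R) (1 : R).
have h1 : \int[(mu \x nu)%E]_z h z = 1.
  transitivity (\int[mu]_x (cst (1 : R) x)).
    by rewrite -Q1// -QE//; apply: eq_Rintegral => z _; rewrite /= !mul1r.
  exact: Rintegral_prob_cst.
have [pi piE] := density_probability bh h_ge0 h1.
have piQ f g : bounded_mfun f -> bounded_mfun g ->
    \int[pi]_z (f z.1 * g z.2) = Q f g.
  move=> bf bg; rewrite -QE// piE//.
  exact: bounded_mfunM (bounded_mfun_fst bf) (bounded_mfun_snd bg).
exists pi => // A mA.
have bA := bounded_mfun_indic (R := R) mA.
split; rewrite Rintegral_indicE// ?[RHS]Rintegral_indicE//;
  try exact: measurableX.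
- congr (_%:E); rewrite -Q1// -piQ//; apply: eq_Rintegral => z _.
  by rewrite /= mulr1 !indicE; congr (_%:R); congr nat_of_bool; apply/idP/idP;
    rewrite !inE /=; [case|].
- congr (_%:E); rewrite -Q2// -piQ//; apply: eq_Rintegral => z _.
  by rewrite /= mul1r !indicE; congr (_%:R); congr nat_of_bool; apply/idP/idP;
    rewrite !inE /=; [case|].
Qed.

End CouplingFromWeights.

(** * The correlation form of two tuples *)

Section CalculusModulo.
Variables (R : realType) (n : nat) (M M' : tracialSpace R).
Variables (X : 'I_n -> M) (X' : 'I_n -> M').
Hypothesis XX' : same_star_distribution X' X.
Hypothesis X_comm : commuting_selfadjoint X.
Implicit Types p q : mpoly.mpoly n R.

Lemma tau_poly_calc p : tau M' (poly_calc X' p) = tau M (poly_calc X p).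
Proof. exact: tau_star_related XX' _ _ (poly_calc_related X X' p). Qed.

Lemma tau_poly_calcM p q (y z : M') :
  tau M' (y * (poly_calc X' p * poly_calc X' q) * z) =
  tau M' (y * poly_calc X' (p * q) * z).
Proof. exact: tau_eq_mod (poly_calcM_mod XX' X_comm p q) y z. Qed.

Lemma tau_poly_calc_adj p (y z : M') :
  tau M' (y * adj (poly_calc X' p) * z) = tau M' (y * poly_calc X' p * z).
Proof. exact: tau_eq_mod (poly_calc_adj_mod XX' X_comm p) y z. Qed.

Lemma trace_inner_poly_calc p :
  trace_inner (poly_calc X' p) (poly_calc X' p) =
  complex.Re (tau M (poly_calc X (p * p))).
Proof.
rewrite /trace_inner -[adj _]mul1r tau_poly_calc_adj mul1r.
by rewrite -tau_poly_calc -[in LHS](mul1r (_ * _)) -[in LHS](mulr1 (1 * _))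
   tau_poly_calcM mul1r mulr1.
Qed.

Lemma trace_inner_adj_poly_calc p :
  trace_inner (adj (poly_calc X' p)) (adj (poly_calc X' p)) =
  complex.Re (tau M (poly_calc X (p * p))).
Proof.
by rewrite -trace_inner_poly_calc /trace_inner adjK tau_trace.
Qed.

End CalculusModulo.

Section Correlation.
Variables (R : realType) (n : nat) (C : R).
Hypothesis C_gt0 : 0 < C.
Variables (M1 M2 M3 : tracialSpace R).
Variables (X : 'I_n -> M1) (Y : 'I_n -> M2) (X' Y' : 'I_n -> M3).
Hypothesis X_comm : commuting_selfadjoint X.
Hypothesis Y_comm : commuting_selfadjoint Y.
Hypothesis XX' : same_star_distribution X' X.
Hypothesis YY' : same_star_distribution Y' Y.
Variables mu nu : probability (n.-tuple R) R.
Hypotheses (X_mu : is_distribution X mu) (Y_nu : is_distribution Y nu).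
Hypothesis mu_box : {ae mu, forall x, in_box C (tnth x)}.
Hypothesis nu_box : {ae nu, forall x, in_box C (tnth x)}.
Implicit Types p q : mpoly.mpoly n R.

Let C_ge0 : 0 <= C := ltW C_gt0.

(** Extends the would-be integral of [p x * q y] under a joint law of [X'] and
    [Y'].  As [X'] and [Y'] do not commute no such law exists in general, but
    the form is bounded, and nonnegative on pairs of polynomials that are
    nonnegative on the box, as the integral would be. *)
Definition correlation p q : R :=
  complex.Re (tau M3 (poly_calc X' p * poly_calc Y' q)).

Lemma correlationDl p1 p2 q :
  correlation (p1 + p2) q = correlation p1 q + correlation p2 q.
Proof. by rewrite /correlation poly_calcD mulrDl linearD Re_add. Qed.

Lemma correlationDr p q1 q2 :
  correlation p (q1 + q2) = correlation p q1 + correlation p q2.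
Proof. by rewrite /correlation poly_calcD mulrDr linearD Re_add. Qed.

Lemma correlationZl c p q : correlation (c *: p) q = c * correlation p q.
Proof. by rewrite /correlation poly_calcZ -scalerAl linearZ Re_realM. Qed.

Lemma correlationZr c p q : correlation p (c *: q) = c * correlation p q.
Proof. by rewrite /correlation poly_calcZ -scalerAr linearZ Re_realM. Qed.

Lemma correlationBl p1 p2 q :
  correlation (p1 - p2) q = correlation p1 q - correlation p2 q.
Proof. by rewrite correlationDl -(scaleN1r p2) correlationZl mulN1r. Qed.

Lemma correlationBr p q1 q2 :
  correlation p (q1 - q2) = correlation p q1 - correlation p q2.
Proof. by rewrite correlationDr -(scaleN1r q2) correlationZr mulN1r. Qed.

Lemma correlation_suml (I : Type) (r : seq I) (F : I -> mpoly.mpoly n R) q :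
  correlation (\sum_(i <- r) F i) q = \sum_(i <- r) correlation (F i) q.
Proof.
elim: r => [|i r ih]; last by rewrite !big_cons correlationDl ih.
by rewrite !big_nil -(scale0r (1 : mpoly.mpoly n R)) correlationZl mul0r.
Qed.

Lemma correlation_sumr (I : Type) (r : seq I) p (F : I -> mpoly.mpoly n R) :
  correlation p (\sum_(i <- r) F i) = \sum_(i <- r) correlation p (F i).
Proof.
elim: r => [|i r ih]; last by rewrite !big_cons correlationDr ih.
by rewrite !big_nil -(scale0r (1 : mpoly.mpoly n R)) correlationZr mul0r.
Qed.

Lemma correlationp1 p : correlation p 1 = moment C mu p.
Proof.
rewrite /correlation poly_calc1 mulr1 (tau_poly_calc XX').
by rewrite (tau_moment C_ge0 mu_box).
Qed.

Lemma correlation1p q : correlation 1 q = moment C nu q.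
Proof.
rewrite /correlation poly_calc1 mul1r (tau_poly_calc YY').
by rewrite (tau_moment C_ge0 nu_box).
Qed.

(** The second moments on the right are classical, since each of them
    involves only one of the two tuples. *)
Lemma correlation_CS p q :
  correlation p q ^+ 2 <= moment C mu (p * p) * moment C nu (q * q).
Proof.
have := trace_inner_CS (adj (poly_calc X' p)) (poly_calc Y' q).
rewrite (trace_inner_adj_poly_calc XX' X_comm).
rewrite (trace_inner_poly_calc YY' Y_comm) /trace_inner adjK.
by rewrite (tau_moment C_ge0 mu_box _ X_mu) (tau_moment C_ge0 nu_box _ Y_nu).
Qed.

Lemma correlation_norm p q (s t : R) : 0 <= s -> 0 <= t ->
  moment C mu (p * p) <= s ^+ 2 -> moment C nu (q * q) <= t ^+ 2 ->
  `|correlation p q| <= s * t.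
Proof.
move=> s0 t0 ps qt; rewrite -(@ler_pXn2r _ 2)// ?nnegrE ?mulr_ge0//.
rewrite (real_normK (num_real _)) exprMn.
apply: le_trans (correlation_CS p q) _.
by apply: ler_pM => //; apply: moment_ge0 => v _;
  rewrite mpoly.mevalM -expr2 sqr_ge0.
Qed.

Lemma correlation_sup p q (s t : R) : 0 <= s -> 0 <= t ->
  (forall v, in_box C v -> `|mpoly.meval v p| <= s) ->
  (forall v, in_box C v -> `|mpoly.meval v q| <= t) ->
  `|correlation p q| <= s * t.
Proof.
by move=> s0 t0 ps qt; apply: correlation_norm => //; exact: moment_square_le.
Qed.

(** By traciality the correlation of [p^2] and [q^2] is the trace of
    [adj T * T] with [T = p(X') q(Y')]. *)
Lemma correlation_square_ge0 p q : 0 <= correlation (p * p) (q * q).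
Proof.
suff -> : correlation (p * p) (q * q) =
    trace_inner (poly_calc X' p * poly_calc Y' q)
                (poly_calc X' p * poly_calc Y' q).
  exact: trace_inner_ge0.
rewrite /trace_inner /correlation; congr complex.Re.
rewrite -[poly_calc X' (p * p)]mul1r -(tau_poly_calcM XX' X_comm) mul1r.
rewrite -[_ * _]mulr1 -(tau_poly_calcM YY' Y_comm) mulr1.
have RX := tau_poly_calc_adj XX' X_comm p.
have RY := tau_poly_calc_adj YY' Y_comm q.
move: (poly_calc X' p) (poly_calc Y' q) RX RY => A B RX RY.
have -> : tau M3 (adj (A * B) * (A * B)) = tau M3 (B * A * (A * B)).
  by rewrite adjM -[adj B]mul1r -[1 * _ * _ * _]mulrA RY mul1r mulrA RX.
by rewrite tau_trace -mulrA tau_trace !mulrA.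
Qed.

(** Both arguments are uniform limits of squares on the box, and the form is
    continuous for uniform convergence there. *)
Lemma correlation_ge0 p q : between01 C p -> between01 C q ->
  0 <= correlation p q.
Proof.
move=> p01 q01; rewrite -oppr_le0; apply/ler_addgt0Pr => e e0; rewrite add0r.
pose d := Num.min 1 (e / 3).
have d0 : 0 < d by rewrite lt_min ltr01 divr_gt0.
have [r rp] := between01_square_limit p01 d0.
have [s sq] := between01_square_limit q01 d0.
have d1 : d <= 1 by rewrite ge_min lexx.
have de : d <= e / 3 by rewrite ge_min lexx orbT.
have cE : correlation p q = correlation (r * r) (s * s) +
    correlation (p - r * r) (s * s) + correlation p (q - s * s).
  by rewrite correlationBl correlationBr; ring.
have ev2 u v : mpoly.meval v (u * u) = mpoly.meval v u ^+ 2 :> R.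
  by rewrite mpoly.mevalM expr2.
have b1 : `|correlation (p - r * r) (s * s)| <= d * 2.
  apply: correlation_sup => [|//|v vC|v vC]; first exact: ltW.
    by rewrite mpoly.mevalB ev2 rp.
  rewrite ev2 ger0_norm ?sqr_ge0//.
  have /andP[q0 q1] := q01 v vC.
  by have := sq v vC; rewrite ler_norml => /andP[]; lra.
have b2 : `|correlation p (q - s * s)| <= 1 * d.
  apply: correlation_sup => [//||v vC|v vC]; first exact: ltW.
    by have /andP[p0 p1] := p01 v vC; rewrite ger0_norm.
  by rewrite mpoly.mevalB ev2 sq.
have b0 := correlation_square_ge0 r s.
rewrite cE; move: b1 b2 b0; rewrite !ler_norml => /andP[h1 _] /andP[h2 _] h3.
lra.
Qed.

End Correlation.

(** * Averages over the cells of a partition *)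

Section ConditionalAverage.
Variables (R : realType) (n : nat) (C : R).
Hypothesis C0 : 0 <= C.
Variable mu : probability (n.-tuple R) R.
Hypothesis mu_box : {ae mu, forall x, in_box C (tnth x)}.
Variables (I : finType) (b : I -> mpoly.mpoly n R).
Hypothesis b1 : \sum_i b i = 1.
Hypothesis b_ge0 : forall i v, in_box C v -> 0 <= mpoly.meval v (b i).

Definition cell_mean (f : mpoly.mpoly n R) i : R :=
  moment C mu (f * b i) / moment C mu (b i).

(** The conditional expectation of [f] given the cell, with the polynomial
    weights [b i] in the role of indicator functions. *)
Definition cell_average (f : mpoly.mpoly n R) : mpoly.mpoly n R :=
  \sum_i cell_mean f i *: b i.

Lemma partition_meval v : \sum_i mpoly.meval v (b i) = 1.
Proof. by rewrite -raddf_sum b1; exact: mpoly.meval1. Qed.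

(** Jensen: the weighted variance of [u] is nonnegative. *)
Lemma weighted_square_le (v : 'I_n -> R) (u : I -> R) : in_box C v ->
  (\sum_i mpoly.meval v (b i) * u i) ^+ 2 <=
  \sum_i mpoly.meval v (b i) * u i ^+ 2.
Proof.
move=> vC; set U := \sum_i _ * u i.
have : 0 <= \sum_i mpoly.meval v (b i) * (u i - U) ^+ 2.
  by apply: sumr_ge0 => i _; rewrite mulr_ge0 ?sqr_ge0 ?b_ge0.
have -> : \sum_i mpoly.meval v (b i) * (u i - U) ^+ 2 =
    \sum_i mpoly.meval v (b i) * u i ^+ 2 - 2 * U * U + U ^+ 2.
  transitivity (\sum_i (mpoly.meval v (b i) * u i ^+ 2 -
     2 * U * (mpoly.meval v (b i) * u i) + U ^+ 2 * mpoly.meval v (b i))).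
    by apply: eq_bigr => i _; ring.
  by rewrite big_split /= sumrB -!mulr_sumr partition_meval mulr1.
move: (\sum_i _ * _ ^+ 2) => S; nra.
Qed.

Lemma cell_mean_moment (f : mpoly.mpoly n R) i :
  cell_mean f i * moment C mu (b i) = moment C mu (f * b i).
Proof.
rewrite /cell_mean.
have [m0|mn0] := eqVneq (moment C mu (b i)) 0; last by rewrite divfK.
rewrite m0 mulr0; apply/esym.
rewrite -[RHS](moment_eq0_Rintegral C0 (b_ge0 i) (bounded_mfun_boxed f C0) m0).
by apply: eq_Rintegral => x _; rewrite boxedM.
Qed.

(** On each cell the mean is the constant nearest to [f] in quadratic mean,
    so it does at least as well as the sample point [c i]. *)
Lemma cell_average_close (f : mpoly.mpoly n R) (c : I -> R) (d : R) :
  (forall v, in_box C v ->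
    \sum_i mpoly.meval v (b i) * (c i - mpoly.meval v f) ^+ 2 <= d) ->
  moment C mu ((cell_average f - f) * (cell_average f - f)) <= d.
Proof.
move=> cd.
pose D i (a : R) : mpoly.mpoly n R :=
  a ^+ 2 *: b i - (2 * a) *: (f * b i) + f * f * b i.
have evD i a v : mpoly.meval v (D i a) =
    mpoly.meval v (b i) * (a - mpoly.meval v f) ^+ 2.
  rewrite /D mpoly.mevalD mpoly.mevalB !mpoly.mevalZ !mpoly.mevalM; ring.
have mD i a : moment C mu (D i a) = a ^+ 2 * moment C mu (b i)
    - 2 * a * moment C mu (f * b i) + moment C mu (f * f * b i).
  by rewrite /D -scaleNr !momentD// !momentZ// mulNr.
apply: (@le_trans _ _ (moment C mu (\sum_i D i (cell_mean f i)))).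
  apply: le_moment => // v vC; rewrite mpoly.mevalM -expr2 mpoly.mevalB.
  have -> : mpoly.meval v (cell_average f) - mpoly.meval v f =
      \sum_i mpoly.meval v (b i) * (cell_mean f i - mpoly.meval v f).
    under [RHS]eq_bigr do rewrite mulrBr.
    rewrite sumrB -mulr_suml partition_meval mul1r raddf_sum /=.
    by congr (_ - _); apply: eq_bigr => i _; rewrite mpoly.mevalZ mulrC.
  rewrite [leRHS]raddf_sum /=; under [leRHS]eq_bigr do rewrite evD.
  exact: weighted_square_le.
apply: (@le_trans _ _ (moment C mu (\sum_i D i (c i)))).
  rewrite !moment_sum//; apply: ler_sum => i _; rewrite !mD.
  rewrite -!(cell_mean_moment f i).
  have m0 : 0 <= moment C mu (b i) by apply: moment_ge0 => v; exact: b_ge0.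
  (* The two quadratics in the constant differ by this square. *)
  have : 0 <= moment C mu (b i) * (cell_mean f i - c i) ^+ 2.
    by rewrite mulr_ge0 ?sqr_ge0.
  nra.
have -> : d = moment C mu (d *: 1) by rewrite momentZ// moment1// mulr1.
apply: le_moment => // v vC; rewrite mpoly.mevalZ mpoly.meval1 mulr1
  [leLHS]raddf_sum /=.
by under eq_bigr do rewrite evD; exact: cd.
Qed.

End ConditionalAverage.

(** * From a pair of tuples to a coupling *)

Section WassersteinLeFree.
Variables (R : realType) (n : nat) (C : R).
Hypothesis C_gt0 : 0 < C.
Variables (M1 M2 M3 : tracialSpace R).
Variables (X : 'I_n -> M1) (Y : 'I_n -> M2) (X' Y' : 'I_n -> M3).
Hypothesis X_comm : commuting_selfadjoint X.
Hypothesis Y_comm : commuting_selfadjoint Y.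
Hypothesis XX' : same_star_distribution X' X.
Hypothesis YY' : same_star_distribution Y' Y.
Variables mu nu : probability (n.-tuple R) R.
Hypotheses (X_mu : is_distribution X mu) (Y_nu : is_distribution Y nu).
Hypothesis mu_box : {ae mu, forall x, in_box C (tnth x)}.
Hypothesis nu_box : {ae nu, forall x, in_box C (tnth x)}.

Local Notation coord j := (mpoly.mpolyX R (mpoly.mnm1 j)).
Local Notation corr := (correlation X' Y').

Let C_ge0 : 0 <= C := ltW C_gt0.

Lemma norm2_diff j : norm2 (X' j - Y' j) ^+ 2 =
  moment C mu (coord j ^+ 2) + moment C nu (coord j ^+ 2) -
  2 * corr (coord j) (coord j).
Proof.
have ti0 := trace_inner_ge0 (X' j - Y' j).
rewrite /norm2 sqr_sqrtr//= -/(trace_inner _ _).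
have -> : trace_inner (X' j - Y' j) (X' j - Y' j) =
    trace_inner (X' j) (X' j) + trace_inner (Y' j) (Y' j)
    - 2 * trace_inner (X' j) (Y' j).
  have inner_opp (a c : M3) : trace_inner a (- c) = - trace_inner a c.
    by rewrite /trace_inner mulrN linearN Re_opp.
  rewrite trace_innerDr inner_opp !(trace_innerC (X' j - Y' j)).
  by rewrite !trace_innerDr !inner_opp (trace_innerC (Y' j) (X' j)); ring.
rewrite -(poly_calcX X' j) -(poly_calcX Y' j).
rewrite (trace_inner_poly_calc XX' X_comm) (trace_inner_poly_calc YY' Y_comm).
rewrite (tau_moment C_ge0 mu_box _ X_mu) (tau_moment C_ge0 nu_box _ Y_nu) /=.
congr (_ - 2 * _); rewrite /trace_inner /correlation.
by rewrite -[adj _]mul1r (tau_poly_calc_adj XX' X_comm) mul1r.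
Qed.

(** Weighting the cells by their correlations gives a coupling under which the
    mixed moment of the coordinates is the correlation of their cell
    averages [T] and [S]; these are near the coordinates in quadratic mean. *)
Lemma coupling_near_correlation (e : R) : 0 < e ->
  exists2 pi : probability (n.-tuple R * n.-tuple R)%type R,
    coupling mu nu pi &
    forall j, `|\int[pi]_z (boxed C (coord j) z.1 * boxed C (coord j) z.2) -
                corr (coord j) (coord j)| <= e.
Proof.
move=> e0; pose s := Num.min 1 (e / (1 + 2 * C)).
have s0 : 0 < s by rewrite lt_min ltr01 divr_gt0// addr_gt0// mulr_gt0.
have s1 : s <= 1 by rewrite ge_min lexx.
have se : s * (1 + 2 * C) <= e.
  by rewrite -ler_pdivlMr ?ge_min ?lexx ?orbT// addr_gt0// mulr_gt0.
have [I [b [c [b1 b0 bc]]]] := partition_of_unity n C_gt0 (exprn_gt0 2 s0).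
have b01 i : between01 C (b i).
  move=> v vC; rewrite b0//= -(partition_meval b1 v) (bigD1 i)//= lerDl.
  by apply: sumr_ge0 => k _; exact: b0.
have p_ge0 i k : 0 <= corr (b i) (b k).
  exact: (correlation_ge0 C_gt0 X_comm Y_comm XX' YY' X_mu Y_nu mu_box nu_box).
have p_row i : \sum_k corr (b i) (b k) = moment C mu (b i).
  by rewrite -correlation_sumr b1 (correlationp1 C_gt0 _ XX' X_mu mu_box).
have p_col k : \sum_i corr (b i) (b k) = moment C nu (b k).
  by rewrite -correlation_suml b1 (correlation1p C_gt0 _ YY' Y_nu nu_box).
have [pi mn_pi piE] := coupling_from_weights C_ge0 mu_box nu_box b1 b1 b0 b0
  p_ge0 p_row p_col.
exists pi => // j.
have bmf p : bounded_mfun (boxed C p : n.-tuple R -> R).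
  exact: bounded_mfun_boxed.
pose T := cell_average C mu b (coord j).
pose S := cell_average C nu b (coord j).
rewrite piE// (_ : \sum_i _ = corr T S); last first.
  rewrite correlation_suml; apply: eq_bigr => i _.
  rewrite correlationZl correlation_sumr mulr_sumr; apply: eq_bigr => k _.
  rewrite correlationZr /cell_mean.
  have mE (la : probability (n.-tuple R) R) i' :
      \int[la]_x (boxed C (coord j) x * boxed C (b i') x) =
      moment C la (coord j * b i').
    by apply: eq_Rintegral => x _; rewrite boxedM.
  by rewrite !mE invfM; ring.
have xC v : in_box C v -> `|mpoly.meval v (coord j)| <= C.
  by move=> vC; rewrite mpoly.mevalXU.
have bcj v : in_box C v ->
    \sum_i mpoly.meval v (b i) * (c i j - mpoly.meval v (coord j)) ^+ 2
    <= s ^+ 2.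
  by move=> vC; rewrite mpoly.mevalXU; exact: bc.
have Tx := cell_average_close C_ge0 mu_box b1 b0 bcj.
have Sx := cell_average_close C_ge0 nu_box b1 b0 bcj.
rewrite -/T in Tx; rewrite -/S in Sx.
have mx := moment_square_le C_ge0 mu_box xC.
have nx := moment_square_le C_ge0 nu_box xC.
have norm_le := correlation_norm C_gt0 X_comm Y_comm XX' YY' X_mu Y_nu mu_box
  nu_box.
have -> : corr T S - corr (coord j) (coord j) =
    corr (T - coord j) (S - coord j) + corr (T - coord j) (coord j) +
    corr (coord j) (S - coord j).
  by rewrite !correlationBl !correlationBr; ring.
(* The three errors add up to at most [s ^+ 2 + 2 * C * s]. *)
have n1 := norm_le _ _ _ _ (ltW s0) (ltW s0) Tx Sx.
have n2 := norm_le _ _ _ _ (ltW s0) C_ge0 Tx nx.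
have n3 := norm_le _ _ _ _ C_ge0 (ltW s0) mx Sx.
apply: le_trans (ler_normD _ _) _; apply: le_trans (lerD (ler_normD _ _) n3) _.
apply: le_trans (lerD (lerD n1 n2) (lexx _)) _; apply: le_trans se.
nra.
Qed.

Lemma wasserstein_le_free_pair : (wasserstein mu nu <=
  (Num.sqrt (\sum_(j < n) norm2 (X' j - Y' j) ^+ 2))%:E)%E.
Proof.
set d := Num.sqrt _.
have d2 : d ^+ 2 = \sum_(j < n) norm2 (X' j - Y' j) ^+ 2.
  by rewrite sqr_sqrtr// sumr_ge0// => j _; exact: sqr_ge0.
apply/lee_addgt0Pr => e e0.
(* There are [n] mixed moments, each counted twice in the cost;
   [n.+1] avoids dividing by zero. *)
have e'0 : 0 < e ^+ 2 / (2 * n.+1%:R) by rewrite divr_gt0 ?exprn_gt0// mulr_gt0.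
have [pi mn_pi piE] := coupling_near_correlation e'0.
apply: le_trans (ereal_inf_lbound _) _; first by exists pi; [exact: mn_pi|].
rewrite (coupling_cost mn_pi C_ge0 mu_box nu_box).
rewrite -EFinD lee_fin.
have d0 : 0 <= d by exact: sqrtr_ge0.
rewrite -[leRHS](ger0_norm (addr_ge0 d0 (ltW e0))) -sqrtr_sqr;
  apply: ler_wsqrtr.
have : d ^+ 2 + e ^+ 2 <= (d + e) ^+ 2 by nra.
apply: le_trans; rewrite d2 -lerBlDl -sumrB.
apply: (@le_trans _ _ (\sum_(j < n) e ^+ 2 / n.+1%:R)).
  apply: ler_sum => j _; rewrite norm2_diff.
  have := piE j; rewrite ler_norml => /andP[+ _].
  have -> : e ^+ 2 / (2 * n.+1%:R) = e ^+ 2 / n.+1%:R / 2 by rewrite invfM;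
    ring.
  move: (\int[pi]_z _) (e ^+ 2 / _) => i t; lra.
rewrite sumr_const card_ord -[leLHS]mulr_natr [leLHS]mulrAC ler_pdivrMr//.
by rewrite ler_wpM2l ?sqr_ge0// ler_nat.
Qed.

End WassersteinLeFree.

(** * The algebra of bounded measurable functions *)

Section BoundedAlgebra.
Context {d : measure_display} {T : measurableType d} {R : realType}.
Implicit Types f g : T -> R[i].

Definition bounded_cfun f :=
  bounded_mfun (fun x => complex.Re (f x)) /\
  bounded_mfun (fun x => complex.Im (f x)).

Lemma bounded_cfun_cst (a : R[i]) : bounded_cfun (fun=> a).
Proof. by split; exact: bounded_mfun_cst. Qed.

Lemma bounded_cfun_real (f : T -> R) :
  bounded_mfun f -> bounded_cfun (fun x => (f x)%:C).
Proof. by move=> bf; split => //=; exact: bounded_mfun_cst. Qed.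

Lemma bounded_cfunD f g : bounded_cfun f -> bounded_cfun g ->
  bounded_cfun (fun x => f x + g x).
Proof.
move=> [rf jf] [rg jg]; split.
- rewrite (_ : (fun _ => _) = (fun x => complex.Re (f x) + complex.Re (g x))).
    exact: bounded_mfunD.
  by apply/funext => x; case: (f x) => ? ?; case: (g x).
- rewrite (_ : (fun _ => _) = (fun x => complex.Im (f x) + complex.Im (g x))).
    exact: bounded_mfunD.
  by apply/funext => x; case: (f x) => ? ?; case: (g x).
Qed.

Lemma bounded_cfunM f g : bounded_cfun f -> bounded_cfun g ->
  bounded_cfun (fun x => f x * g x).
Proof.
move=> [rf jf] [rg jg]; split.
- rewrite (_ : (fun _ => _) = (fun x => complex.Re (f x) * complex.Re (g x) -
     complex.Im (f x) * complex.Im (g x))).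
    by apply: bounded_mfunB; exact: bounded_mfunM.
  by apply/funext => x; case: (f x) => ? ?; case: (g x).
- rewrite (_ : (fun _ => _) = (fun x => complex.Re (f x) * complex.Im (g x) +
     complex.Im (f x) * complex.Re (g x))).
    by apply: bounded_mfunD; exact: bounded_mfunM.
  by apply/funext => x; case: (f x) => ? ?; case: (g x).
Qed.

Lemma bounded_cfunN f : bounded_cfun f -> bounded_cfun (fun x => - f x).
Proof.
by move=> /(bounded_cfunM (bounded_cfun_cst (-1)));
  under eq_fun do rewrite mulN1r.
Qed.

Lemma bounded_cfun_conj f : bounded_cfun f ->
  bounded_cfun (fun x => conjc (f x)).
Proof.
move=> [rf jf]; split.
- rewrite (_ : (fun _ => _) = (fun x => complex.Re (f x)))//.
  by apply/funext => x; case: (f x).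
- rewrite (_ : (fun _ => _) = (fun x => - complex.Im (f x))).
    exact: bounded_mfunN.
  by apply/funext => x; case: (f x).
Qed.

Lemma bounded_cfun_modulus f : bounded_cfun f ->
  exists K, forall x, modulus (f x) <= K.
Proof.
move=> [[_ [K fK]] [_ [L fL]]]; exists (K + L) => x.
by apply: le_trans (modulus_le_ReIm _) _; apply: lerD.
Qed.

End BoundedAlgebra.

(** All functions are kept, not classes modulo null sets, so that the norm is a
    plain supremum and no measure enters; the trace defined below by an
    integral is then not faithful in general. *)
Record bounded_algebra (d : measure_display) (T : measurableType d)
    (R : realType) := BoundedAlgebra {
  bounded_val :> T -> R[i];
  bounded_valP : bounded_cfun bounded_val
}.

Section BoundedAlgebraStructure.
Context {d : measure_display} {T : measurableType d} {R : realType}.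
Local Notation A := (bounded_algebra T R).
Implicit Types f g h : A.

Lemma bounded_algebra_ext f g : (forall x, f x = g x) -> f = g.
Proof.
case: f g => [f fP] [g gP] /= /funext fg; subst g.
by congr BoundedAlgebra; exact: Prop_irrelevance.
Qed.

HB.instance Definition _ := gen_eqMixin A.
HB.instance Definition _ := gen_choiceMixin A.

Let cst_A (a : R[i]) : A := BoundedAlgebra (bounded_cfun_cst a).
Let add_A f g : A :=
  BoundedAlgebra (bounded_cfunD (bounded_valP f) (bounded_valP g)).
Let mul_A f g : A :=
  BoundedAlgebra (bounded_cfunM (bounded_valP f) (bounded_valP g)).
Let opp_A f : A := BoundedAlgebra (bounded_cfunN (bounded_valP f)).
Let scale_A (a : R[i]) f : A :=
  BoundedAlgebra (bounded_cfunM (bounded_cfun_cst a) (bounded_valP f)).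

Let add_AA : associative add_A.
Proof. by move=> f g h; apply: bounded_algebra_ext => x /=; rewrite addrA. Qed.
Let add_AC : commutative add_A.
Proof. by move=> f g; apply: bounded_algebra_ext => x /=; rewrite addrC. Qed.
Let add_0A : left_id (cst_A 0) add_A.
Proof. by move=> f; apply: bounded_algebra_ext => x /=; rewrite add0r. Qed.
Let add_NA : left_inverse (cst_A 0) opp_A add_A.
Proof. by move=> f; apply: bounded_algebra_ext => x /=; rewrite addNr. Qed.

HB.instance Definition _ := GRing.isZmodule.Build A add_AA add_AC add_0A add_NA.

Let mul_AA : associative mul_A.
Proof. by move=> f g h; apply: bounded_algebra_ext => x /=; rewrite mulrA. Qed.
Let mul_1A : left_id (cst_A 1) mul_A.
Proof. by move=> f; apply: bounded_algebra_ext => x /=; rewrite mul1r. Qed.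
Let mul_A1 : right_id (cst_A 1) mul_A.
Proof. by move=> f; apply: bounded_algebra_ext => x /=; rewrite mulr1. Qed.
Let mul_ADl : left_distributive mul_A +%R.
Proof. by move=> f g h; apply: bounded_algebra_ext => x /=; rewrite mulrDl. Qed.
Let mul_ADr : right_distributive mul_A +%R.
Proof. by move=> f g h; apply: bounded_algebra_ext => x /=; rewrite mulrDr. Qed.
Let one_A_neq0 : cst_A 1 != 0.
Proof.
apply/eqP => /(congr1 (fun f : A => f point)) /= /eqP.
by rewrite oner_eq0.
Qed.

HB.instance Definition _ := GRing.Zmodule_isNzRing.Build A
  mul_AA mul_1A mul_A1 mul_ADl mul_ADr one_A_neq0.

Let scale_AA a b f : scale_A a (scale_A b f) = scale_A (a * b) f.
Proof. by apply: bounded_algebra_ext => x /=; rewrite mulrA. Qed.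
Let scale_1A : left_id 1 scale_A.
Proof. by move=> f; apply: bounded_algebra_ext => x /=; rewrite mul1r. Qed.
Let scale_ADr : right_distributive scale_A +%R.
Proof. by move=> a f g; apply: bounded_algebra_ext => x /=; rewrite mulrDr. Qed.
Let scale_ADl f : {morph scale_A^~ f : a b / a + b}.
Proof. by move=> a b; apply: bounded_algebra_ext => x /=; rewrite mulrDl. Qed.

HB.instance Definition _ := GRing.Zmodule_isLmodule.Build R[i] A
  scale_AA scale_1A scale_ADr scale_ADl.

Let scale_AMl (a : R[i]) f g : a *: (f * g) = a *: f * g.
Proof. by apply: bounded_algebra_ext => x /=; rewrite mulrA. Qed.

HB.instance Definition _ := GRing.Lmodule_isLalgebra.Build R[i] A scale_AMl.

Let scale_AMr (a : R[i]) f g : a *: (f * g) = f * (a *: g).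
Proof. by apply: bounded_algebra_ext => x /=; rewrite mulrCA. Qed.

HB.instance Definition _ := GRing.Lalgebra_isAlgebra.Build R[i] A scale_AMr.

Lemma bounded_mulE f g x : (f * g) x = f x * g x. Proof. by []. Qed.

Definition sup_norm f : R := sup (range (fun x => modulus (f x))).

Lemma modulus_le_sup_norm f x : modulus (f x) <= sup_norm f.
Proof.
apply: ub_le_sup; last by exists x.
have [K fK] := bounded_cfun_modulus (bounded_valP f).
by exists K => _ [y _ <-].
Qed.

Lemma sup_norm_le f (K : R) : (forall x, modulus (f x) <= K) -> sup_norm f <= K.
Proof.
move=> fK; apply: ge_sup; first by exists (modulus (f point)), point.
by move=> _ [y _ <-].
Qed.

Lemma sup_norm_ge0 f : 0 <= sup_norm f.
Proof. exact: le_trans (modulus_ge0 _) (modulus_le_sup_norm f point). Qed.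

Definition bounded_adj f : A :=
  BoundedAlgebra (bounded_cfun_conj (bounded_valP f)).

Let bounded_adjK : involutive bounded_adj.
Proof. by move=> f; apply: bounded_algebra_ext => x /=; exact: conjcK. Qed.

Let bounded_adjD : {morph bounded_adj : f g / f + g}.
Proof. by move=> f g; apply: bounded_algebra_ext => x /=; exact: rmorphD. Qed.

Let bounded_adjZ (a : R[i]) f : bounded_adj (a *: f) = a^* *: bounded_adj f.
Proof. by apply: bounded_algebra_ext => x /=; exact: rmorphM. Qed.

Let bounded_adjM f g : bounded_adj (f * g) = bounded_adj g * bounded_adj f.
Proof.
by apply: bounded_algebra_ext => x /=; rewrite mulrC; exact: rmorphM.
Qed.

Let sup_norm0_eq0 f : sup_norm f = 0 -> f = 0.
Proof.
move=> f0; apply: bounded_algebra_ext => x; apply: modulus_eq0.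
by apply/le_anti; rewrite modulus_ge0 andbT -f0 modulus_le_sup_norm.
Qed.

Let sup_normD f g : sup_norm (f + g) <= sup_norm f + sup_norm g.
Proof.
apply: sup_norm_le => x; apply: le_trans (modulusD _ _) _.
by apply: lerD; exact: modulus_le_sup_norm.
Qed.

Let sup_normM f g : sup_norm (f * g) <= sup_norm f * sup_norm g.
Proof.
apply: sup_norm_le => x; rewrite modulusM.
by apply: ler_pM; rewrite ?modulus_ge0 ?modulus_le_sup_norm.
Qed.

Let sup_normZ (a : R[i]) f : sup_norm (a *: f) = complex.Re `|a| * sup_norm f.
Proof.
rewrite -/(modulus a); apply/le_anti/andP; split.
  apply: sup_norm_le => x; rewrite modulusM ler_wpM2l ?modulus_ge0//.
  exact: modulus_le_sup_norm.
have [->|an0] := eqVneq (modulus a) 0; first by rewrite mul0r sup_norm_ge0.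
have a0 : 0 < modulus a by rewrite lt_def an0 modulus_ge0.
rewrite -ler_pdivlMl//; apply: sup_norm_le => x;
  rewrite ler_pdivlMl// -modulusM.
exact: (modulus_le_sup_norm (a *: f) x).
Qed.

Let sup_norm_cstar f : sup_norm (bounded_adj f * f) = sup_norm f ^+ 2.
Proof.
apply/le_anti/andP; split.
  apply: sup_norm_le => x; rewrite modulusM modulus_conj -expr2.
  by apply: lerXn2r; rewrite ?nnegrE ?modulus_ge0 ?sup_norm_ge0
    ?modulus_le_sup_norm.
rewrite -[leRHS]sqr_sqrtr ?sup_norm_ge0//.
apply: lerXn2r; rewrite ?nnegrE ?sqrtr_ge0 ?sup_norm_ge0//.
apply: sup_norm_le => x; rewrite -[leLHS]ger0_norm ?modulus_ge0// -sqrtr_sqr.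
apply: ler_wsqrtr; have := modulus_le_sup_norm (bounded_adj f * f) x.
by rewrite modulusM modulus_conj -expr2.
Qed.

Let sup_norm_complete (u : nat -> A) :
  (forall e : R, 0 < e -> exists N, forall m k : nat,
     (N <= m)%N -> (N <= k)%N -> sup_norm (u m - u k) < e) ->
  exists l : A, forall e : R, 0 < e -> exists N, forall m : nat,
    (N <= m)%N -> sup_norm (u m - l) < e.
Proof.
move=> cu.
have Cauchy_part (F : R[i] -> R) : (forall a b, F (a - b) = F a - F b) ->
    (forall a, `|F a| <= modulus a) ->
    forall e : R, 0 < e -> exists N, forall m k, (N <= m)%N -> (N <= k)%N ->
      forall x, `|F (u m x) - F (u k x)| <= e.
  move=> FB Fle e e0; have [N HN] := cu e e0; exists N => m k Nm Nk x.
  rewrite -FB; apply: le_trans (Fle _) _; apply: le_trans (ltW (HN m k Nm Nk)).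
  exact: (modulus_le_sup_norm (u m - u k) x).
have ReB (a b : R[i]) : complex.Re (a - b) = complex.Re a - complex.Re b.
  by case: a; case: b.
have ImB (a b : R[i]) : complex.Im (a - b) = complex.Im a - complex.Im b.
  by case: a; case: b.
have [lr [blr lrP]] := bounded_mfun_uniform_limit
  (fun m => (bounded_valP (u m)).1) (Cauchy_part _ ReB (@Re_le_modulus R)).
have [li [bli liP]] := bounded_mfun_uniform_limit
  (fun m => (bounded_valP (u m)).2) (Cauchy_part _ ImB (@Im_le_modulus R)).
have bl : bounded_cfun (fun x => lr x +i* li x) by [].
exists (BoundedAlgebra bl) => e e0.
have e30 : 0 < e / 3 by rewrite divr_gt0.
have [N1 HN1] := lrP _ e30; have [N2 HN2] := liP _ e30.
exists (maxn N1 N2) => m; rewrite geq_max => /andP[Nm1 Nm2].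
apply: (@le_lt_trans _ _ (e / 3 + e / 3)); last lra.
apply: sup_norm_le => x; apply: le_trans (modulus_le_ReIm _) _.
by apply: lerD; rewrite ?ReB ?ImB; [exact: HN1|exact: HN2].
Qed.

HB.instance Definition _ := isCstarAlgebra.Build R A
  bounded_adjK bounded_adjD bounded_adjZ bounded_adjM
  sup_norm0_eq0 sup_normD sup_normZ sup_normM sup_norm_cstar sup_norm_complete.

Lemma adj_boundedE f x : adj f x = conjc (f x). Proof. by []. Qed.

End BoundedAlgebraStructure.

(** * From a coupling to a pair of tuples *)

Section IntegralTrace.
Context {d : measure_display} {T : measurableType d} {R : realType}.
Variable P : probability T R.
Local Notation A := (bounded_algebra T R).

Definition complex_integral (f : T -> R[i]) : R[i] :=
  (\int[P]_x complex.Re (f x)) +i* (\int[P]_x complex.Im (f x)).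

Definition integral_trace (f : A) : R[i] := complex_integral f.

Lemma integral_trace_linear : linear_for *%R integral_trace.
Proof.
move=> a f g; rewrite /integral_trace /complex_integral.
have [rf jf] := bounded_valP f; have [rg jg] := bounded_valP g.
have int u : bounded_mfun u -> P.-integrable setT (EFin \o u).
  exact: bounded_mfun_integrable.
case: a => a b /=.
rewrite [X in X +i* _](_ : _ = \int[P]_x (a * complex.Re (f x) +
    (- b) * complex.Im (f x) + complex.Re (g x))); last first.
  apply: eq_Rintegral => x _ /=.
  by case: (f x) => ? ?; case: (g x) => ? ? /=; ring.
rewrite [X in _ +i* X](_ : _ = \int[P]_x (a * complex.Im (f x) +
    b * complex.Re (f x) + complex.Im (g x))); last first.
  apply: eq_Rintegral => x _ /=.
  by case: (f x) => ? ?; case: (g x) => ? ? /=; ring.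
rewrite !RintegralD ?RintegralZl//; try apply: int => //;
  try exact: bounded_mfunZ;
  try by apply: bounded_mfunD; exact: bounded_mfunZ.
by apply/eqP; rewrite eq_complex /=; apply/andP; split; apply/eqP; ring.
Qed.

HB.instance Definition _ := GRing.isLinear.Build R[i] A R[i] *%R integral_trace
  integral_trace_linear.

Lemma integral_trace1 : integral_trace 1 = 1.
Proof.
by apply/eqP; rewrite eq_complex /=; apply/andP; split; apply/eqP;
  exact: Rintegral_prob_cst.
Qed.

Lemma integral_trace_ge0 f : 0 <= integral_trace (adj f * f).
Proof.
rewrite lecE /=; apply/andP; split.
  apply/eqP; rewrite (_ : (fun _ => _) = (fun=> 0)) ?Rintegral_prob_cst//.
  by apply/funext => x; case: (f x) => a b /=; ring.
apply: Rintegral_ge0 => x _; case: (f x) => a b /=.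
by rewrite mulNr opprK addr_ge0// -expr2 sqr_ge0.
Qed.

Lemma integral_traceC f g : integral_trace (f * g) = integral_trace (g * f).
Proof.
by congr integral_trace; apply: bounded_algebra_ext => x; exact: mulrC.
Qed.

Definition function_space : tracialSpace R :=
  @TracialSpace R A integral_trace integral_trace1 integral_trace_ge0
    integral_traceC.

End IntegralTrace.

Section FreeLeWasserstein.
Variables (R : realType) (n : nat) (C : R).
Hypothesis C_gt0 : 0 < C.
Local Notation coord j := (mpoly.mpolyX R (mpoly.mnm1 j)).

Let C_ge0 : 0 <= C := ltW C_gt0.

Lemma complex_integral_real d (T : measurableType d) (P : probability T R)
    (f : T -> R) : complex_integral P (fun x => (f x)%:C) = (\int[P]_x f x)%:C.
Proof. by rewrite /complex_integral /= Rintegral_prob_cst. Qed.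

(** The coordinates are cut off to be bounded; as [mu] is carried by the box
    this does not change their joint moments. *)
Lemma same_star_distribution_functions d (T : measurableType d)
    (P : probability T R) (M : tracialSpace R) (X : 'I_n -> M)
    (mu : probability (n.-tuple R) R) (p : T -> n.-tuple R)
    (Z : 'I_n -> function_space P) :
  commuting_selfadjoint X -> is_distribution X mu ->
  {ae mu, forall x, in_box C (tnth x)} ->
  (forall f, bounded_mfun f -> \int[P]_z f (p z) = \int[mu]_x f x) ->
  (forall j z, (Z j : bounded_algebra T R) z = (boxed C (coord j) (p z))%:C) ->
  same_star_distribution Z X.
Proof.
move=> X_comm X_mu mu_box pE ZE Q; rewrite /star_eval !linear_sum /=.
apply: eq_bigr => w _; rewrite !linearZ /=; congr (_ * _).
move: (monalg.fmonom_val w) => {Q}w.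
rewrite (poly_calc_word X_comm w) (tau_moment C_ge0 mu_box _ X_mu).
pose g (x : n.-tuple R) := \prod_(l <- w) boxed C (coord l.1) x.
have bg : bounded_mfun g.
  rewrite /g; elim: w {g} => [|l w ih].
    by under eq_fun do rewrite big_nil; exact: bounded_mfun_cst.
  under eq_fun do rewrite big_cons.
  by apply: bounded_mfunM => //; exact: bounded_mfun_boxed.
transitivity (complex_integral P (fun z => (g (p z))%:C)).
  rewrite /integral_trace; congr complex_integral; apply/funext => z.
  rewrite /g; elim: w {g bg} => [|l w ih]; first by rewrite !big_nil.
  rewrite !big_cons; apply: etrans (esym (rmorphM _ _ _));
    rewrite -[X in _ = _ * X]ih.
  apply: etrans (bounded_mulE _ _ z) _; congr (_ * _).
  by case: l => j [] /=; rewrite ?adj_boundedE ZE ?conjc_real.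
rewrite complex_integral_real pE//; congr (_%:C); rewrite /moment; congr fine.
apply: ae_eq_integral => //.
- by apply/measurable_EFinP; exact: bg.1.
- by apply/measurable_EFinP; exact: (bounded_mfun_boxed _ C_ge0).1.
- apply: filterS mu_box => x xC _; congr (_%:E); rewrite boxedE// rmorph_prod.
  by apply: eq_bigr => l _; rewrite boxedE.
Qed.

Variables (M1 M2 : tracialSpace R) (X : 'I_n -> M1) (Y : 'I_n -> M2).
Hypothesis X_comm : commuting_selfadjoint X.
Hypothesis Y_comm : commuting_selfadjoint Y.
Variables mu nu : probability (n.-tuple R) R.
Hypotheses (X_mu : is_distribution X mu) (Y_nu : is_distribution Y nu).
Hypothesis mu_box : {ae mu, forall x, in_box C (tnth x)}.
Hypothesis nu_box : {ae nu, forall x, in_box C (tnth x)}.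

Lemma free_le_coupling_cost (pi : probability (n.-tuple R * n.-tuple R)%type R)
  :
  coupling mu nu pi ->
  (free_wasserstein X Y <= sqrte (\int[pi]_z
    (\sum_(j < n) (tnth z.1 j - tnth z.2 j) ^+ 2)%:E))%E.
Proof.
move=> mn_pi.
have b1 (j : 'I_n) := bounded_cfun_real (bounded_mfun_fst (T2 := n.-tuple R)
  (bounded_mfun_boxed (coord j) C_ge0)).
have b2 (j : 'I_n) := bounded_cfun_real (bounded_mfun_snd (T1 := n.-tuple R)
  (bounded_mfun_boxed (coord j) C_ge0)).
pose X' j : function_space pi := BoundedAlgebra (b1 j).
pose Y' j : function_space pi := BoundedAlgebra (b2 j).
have XX' : same_star_distribution X' X.
  apply: (same_star_distribution_functions (p := fst) X_comm X_mu mu_box) => //.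
  by move=> f; exact: (Rintegral_coupling_fst mn_pi).
have YY' : same_star_distribution Y' Y.
  apply: (same_star_distribution_functions (p := snd) Y_comm Y_nu nu_box) => //.
  by move=> f; exact: (Rintegral_coupling_snd mn_pi).
apply: ereal_inf_lbound; exists (function_space pi), X', Y'; split => //.
rewrite (coupling_cost mn_pi C_ge0 mu_box nu_box) /=; congr (Num.sqrt _)%:E.
apply: eq_bigr => j _.
rewrite (norm2_diff C_gt0 X_comm Y_comm XX' YY' X_mu Y_nu mu_box nu_box).
congr (_ - 2 * _); rewrite /correlation !poly_calcX /= /integral_trace /=.
by apply: eq_Rintegral => z _ /=; rewrite mul0r subr0.
Qed.

End FreeLeWasserstein.

Theorem theorem1p5 (R : realType) (n : nat) (M1 M2 : tracialSpace R)
    (X : 'I_n -> M1) (Y : 'I_n -> M2)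
    (X_comm : commuting_selfadjoint X) (Y_comm : commuting_selfadjoint Y)
    (mu nu : probability (n.-tuple R) R)
    (X_mu : is_distribution X mu) (Y_nu : is_distribution Y nu) :
  free_wasserstein X Y = wasserstein mu nu.
Proof.
have [C1 HC1] := compactly_supported_box X_mu.1.
have [C2 HC2] := compactly_supported_box Y_nu.1.
pose C := Num.max 1 (Num.max C1 C2).
have C_gt0 : 0 < C by rewrite lt_max ltr01.
have mu_box : {ae mu, forall x, in_box C (tnth x)}.
  by apply: HC1; rewrite !le_max lexx orbT.
have nu_box : {ae nu, forall x, in_box C (tnth x)}.
  by apply: HC2; rewrite !le_max lexx !orbT.
apply/eqP; rewrite eq_le; apply/andP; split.
  apply/ereal_infP => _ [pi mn_pi ->].
  exact: (free_le_coupling_cost C_gt0 X_comm Y_comm X_mu Y_nu mu_box nu_box).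
apply/ereal_infP => _ [M3 [X' [Y' [XX' YY' ->]]]].
exact: (wasserstein_le_free_pair C_gt0 X_comm Y_comm XX' YY' X_mu Y_nu
  mu_box nu_box).
Qed.
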